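(* Let $M^n(c)$ be an $n$-dimensional Riemannian manifold of constant sectional curvature $c$, let $f\colon M^n(c)\to \mathbb{Q}^{n+p}_s(\tilde c)$ be an isometric immersion and let $\tilde f\colon \tilde M^n\to \mathbb{Q}^{n+p}_s(\tilde c)$ be an $L$-transform of $f$. Then $\tilde M^n$ also has constant sectional curvature $c$.
   Context: $\mathbb{Q}^{n+p}_s(\tilde c)$ is the pseudo-Riemannian space form of dimension $n+p$, index $s$ and constant sectional curvature $\tilde c$; $i\colon \mathbb{Q}^{n+p}_s(\tilde c)\to\mathbb{R}^{n+p+1}_{s+\epsilon_0}$ is the umbilical inclusion ($\epsilon_0=0$ if $\tilde c>0$, $\epsilon_0=1$ if $\tilde c<0$), and $F=i\circ f$; if $\tilde c=0$ then $\mathbb{Q}^{n+p}_s(0)=\mathbb{R}^{n+p}_s$, $i$ is the identity and $F=f$. For an isometric immersion $f$ of a Riemannian manifold $M^n$, $N_fM$ is the normal bundle, $\nabla^\perp$ the normal connection, $\alpha$ the second fundamental form, $A_\xi$ the shape operators, and $A(X)\xi=A_\xi X$. The superscript $t$ denotes the transpose with respect to the relevant inner products. Vectorial Ribaucour transform. Let $V$ be a (finite-dimensional) Euclidean vector space, identified with the trivial bundle $M\times V$ with its flat connection; $V^*\otimes V$ is identified with the endomorphisms of $V$. Let $\varphi\colon M\to V$ be smooth, $\omega=d\varphi$, $\omega^t\in\Gamma(V^*\otimes TM)$ given by $\langle\omega^t(v),X\rangle=\langle v,\omega(X)\rangle$, $\varphi^t(v)=\langle\varphi,v\rangle$, and let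 $\beta\in\Gamma(V^*\otimes N_fM)$ satisfy, for all $X$ and $u,v$, $\alpha(X,\omega^t(v))+(\nabla_X\beta)v=0$ (where $(\nabla_X\beta)v=\nabla^\perp_X(\beta(v))-\beta(\nabla_X v)$) and $[\Phi_u,\Phi_v]=0$, where $\Phi_vX=\Phi(X)(v)=(\nabla_X\omega^t)v-A_{\beta(v)}X+\tilde c\,\varphi^t(v)X$. Put $\mathcal{G}=F_*\omega^t+i_*\beta+\tilde cF\varphi^t$, and let $\Omega\in\Gamma(V^*\otimes V)$ be everywhere invertible with $d\Omega=\mathcal{G}^td\mathcal{G}$ (equivalently $d\Omega(X)=\omega\,\Phi(X)$) and $\Omega+\Omega^t=\mathcal{G}^t\mathcal{G}$. The vectorial Ribaucour transform $\tilde f=\mathcal{R}_{\varphi,\beta,\Omega}(f)\colon\tilde M^n\to\mathbb{Q}^{n+p}_s(\tilde c)$ is defined by $i\circ\tilde f=F-\mathcal{G}\Omega^{-1}\varphi$, where $\tilde M^n\subset M^n$ is the set of regular points of $\tilde f$ endowed with the induced metric. $L$-transform. If $f\colon M^n(c)\to \mathbb{Q}^{n+p}_s(\tilde c)$, $\tilde f=\mathcal{R}_{\varphi,\beta,\Omega}(f)$ is an $L$-transform of $f$, written $\mathcal{R}_{\varphi,\beta,\Omega,L}(f)$, if there is $L\in V^*\otimes V$ such that $\Phi(Y)L+A(Y)\beta+(c-\tilde c)Y\varphi^t=0$ for all tangent $Y$ and $\Omega L+L^t\Omega^t=\rho$, where $\rho=\beta^t\beta-(c-\tilde c)\varphi\varphi^t$.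 *)

(* Defs.v *)
(* Vectors are columns; a matrix acts on them by multiplication on the left.  *)
From HB Require Import structures.
From mathcomp Require Import all_boot all_order all_algebra.
From mathcomp Require Import boolp classical_sets reals topology normedtype.
From mathcomp Require Import derive.

Set Implicit Arguments.
Unset Strict Implicit.
Unset Printing Implicit Defensive.

Import Order.TTheory GRing.Theory Num.Theory.
Import numFieldNormedType.Exports.

Local Open Scope classical_set_scope.
Local Open Scope ring_scope.

Section Calculus.
Variables (R : realType) (n : nat).

Fixpoint Ck (W : normedModType R) (A : set 'cV[R]_n) (k : nat)
    (h : 'cV[R]_n -> W) : Prop :=
  if k is k'.+1 then
    (forall u, A u -> differentiable h u) /\
    (forall v : 'cV[R]_n, Ck A k' ('D_v h))
  else forall u, A u -> {for u, continuous h}.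

(* Only used for open A. *)
Definition smooth_on (W : normedModType R) (A : set 'cV[R]_n)
    (h : 'cV[R]_n -> W) : Prop :=
  forall k, Ck A k h.

Definition jac (m : nat) (h : 'cV[R]_n -> 'cV[R]_m) (u : 'cV[R]_n) :
    'M[R]_(m, n) :=
  \matrix_(a < m, i < n) 'D_(delta_mx i 0 : 'cV[R]_n) h u a 0.

End Calculus.

Definition form (R : realType) (m : nat) (A : 'M[R]_m) (x y : 'cV[R]_m) : R :=
  (x^T *m A *m y) 0 0.

Definition dot (R : realType) (m : nat) (x y : 'cV[R]_m) : R := form 1%:M x y.

(* Geometry of a metric g given in coordinates: g u is the Gram matrix of the *)
(* coordinate fields at u, a tangent vector is its column of components, and  *)
(* a vector also stands for the coordinate field with constant components.    *)
Section CoordinateMetric.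
Variables (R : realType) (n : nat) (g : 'cV[R]_n -> 'M[R]_n).
Implicit Types (u X Y Z : 'cV[R]_n).

(* nabla_X Y for constant X and Y. The Koszul formula has no bracket terms:   *)
(* 2 <nabla_X Y, e_l> = X <Y, e_l> + Y <X, e_l> - e_l <X, Y>.                 *)
Definition christoffel u X Y : 'cV[R]_n :=
  2^-1 *: (invmx (g u) *m
    ('D_X g u *m Y + 'D_Y g u *m X
     - \col_(l < n) form ('D_(delta_mx l 0 : 'cV[R]_n) g u) X Y)).

Definition nabla X (Y : 'cV[R]_n -> 'cV[R]_n) u : 'cV[R]_n :=
  'D_X Y u + christoffel u X (Y u).

(* R(X, Y) Z = nabla_X nabla_Y Z - nabla_Y nabla_X Z - nabla_[X, Y] Z, the    *)
(* last term vanishing for the constant extensions of X, Y, Z.                *)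
Definition curvature u X Y Z : 'cV[R]_n :=
  nabla X (nabla Y (fun=> Z)) u - nabla Y (nabla X (fun=> Z)) u.

Definition sectional_curvature u X Y : R :=
  form (g u) (curvature u X Y Y) X /
  (form (g u) X X * form (g u) Y Y - form (g u) X Y ^+ 2).

End CoordinateMetric.

Section Manifolds.
Variables (R : realType) (n : nat).

(* coord matters on dom only, and its inverse param on the image of dom only. *)
Record chart (M : topologicalType) := Chart {
  dom : set M;
  coord : M -> 'cV[R]_n;
  param : 'cV[R]_n -> M }.

Definition chart_codom (M : topologicalType) (k : chart M) : set 'cV[R]_n :=
  coord k @` dom k.

Definition is_chart (M : topologicalType) (k : chart M) : Prop :=
  [/\ open (dom k),
      open (chart_codom k),
      forall x, dom k x -> param k (coord k x) = x,
      forall x, dom k x -> {for x, continuous (coord k)} &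
      forall u, chart_codom k u -> {for u, continuous (param k)}].

Definition overlap (M : topologicalType) (k k' : chart M) : set 'cV[R]_n :=
  chart_codom k `&` param k @^-1` dom k'.

Definition transition (M : topologicalType) (k k' : chart M) :
    'cV[R]_n -> 'cV[R]_n :=
  coord k' \o param k.

Record smooth_manifold := SmoothManifold {
  carrier :> topologicalType;
  atlas : set (chart carrier);
  manifold_hausdorff : hausdorff_space carrier;
  manifold_countable : @second_countable carrier;
  atlas_chart : forall k, atlas k -> is_chart k;
  atlas_cover : forall x, exists2 k, atlas k & dom k x;
  atlas_smooth : forall k k', atlas k -> atlas k' ->
    smooth_on (overlap k k') (transition k k') }.

Definition smooth_map (M : smooth_manifold) (W : normedModType R)
    (h : M -> W) : Prop :=
  forall k, atlas k -> smooth_on (chart_codom k) (h \o param k).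

(* A symmetric 2-tensor field is given by its components in every chart.      *)
Definition tensor2 (M : smooth_manifold) := chart M -> 'cV[R]_n -> 'M[R]_n.

(* g is a Riemannian metric on the open submanifold S of M, whose charts are  *)
(* the restrictions to S of those of M.                                       *)
Definition riemannian_on (M : smooth_manifold) (S : set M) (g : tensor2 M) :
    Prop :=
  [/\ open S,
      forall k, atlas k -> smooth_on (chart_codom k `&` param k @^-1` S) (g k),
      forall k u, atlas k -> chart_codom k u -> S (param k u) ->
        (g k u)^T = g k u,
      forall k u, atlas k -> chart_codom k u -> S (param k u) ->
        forall X : 'cV[R]_n, X != 0 -> 0 < form (g k u) X X &
      forall k k' u, atlas k -> atlas k' -> overlap k k' u -> S (param k u) ->
        g k u = (jac (transition k k') u)^T *m g k' (transition k k' u)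
                *m jac (transition k k') u].

Definition constant_curvature_on (M : smooth_manifold) (S : set M)
    (g : tensor2 M) (c : R) : Prop :=
  riemannian_on S g /\
  forall k u, atlas k -> chart_codom k u -> S (param k u) ->
  forall X Y : 'cV[R]_n, \rank (row_mx X Y) = 2%N ->
    sectional_curvature (g k) u X Y = c.

End Manifolds.

Section PseudoEuclidean.
Variables (R : realType) (N nu : nat).

Definition eta : 'M[R]_N :=
  diag_mx (\row_(a < N) (if (a < nu)%N then -1 else 1)).

Definition ip (x y : 'cV[R]_N) : R := form eta x y.

Definition gram (n : nat) (F : 'cV[R]_n -> 'cV[R]_N) (u : 'cV[R]_n) : 'M[R]_n :=
  (jac F u)^T *m eta *m jac F u.

Definition induced_metric (n : nat) (M : smooth_manifold R n)
    (f : M -> 'cV[R]_N) : tensor2 M :=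
  fun k => gram (f \o param k).

Definition regular_points (n : nat) (M : smooth_manifold R n)
    (f : M -> 'cV[R]_N) : set M :=
  [set x | forall k, atlas k -> dom k x ->
     \rank (jac (f \o param k) (coord k x)) = n].

(* The space form of curvature ct, as a subset of pseudo-Euclidean space; it  *)
(* is the whole of it when ct = 0. Its tangent space at q is the set of y     *)
(* with ct <y, q> = 0.                                                        *)
Definition space_form (ct : R) : set 'cV[R]_N :=
  [set q | ct != 0 -> ip q q = ct^-1].

(* An isometric immersion in coordinates, followed by the inclusion of the    *)
(* space form: i_* is the identity on vectors, so that alpha, nabla^perp and  *)
(* the normal bundle are those of f, with values in pseudo-Euclidean space.   *)
Section CoordinateImmersion.
Variables (n : nat) (ct : R).
Variables (g : 'cV[R]_n -> 'M[R]_n) (F : 'cV[R]_n -> 'cV[R]_N).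
Implicit Types (u X Y : 'cV[R]_n) (w xi : 'cV[R]_N).

(* The T with <F_* T, F_* Y> = <w, F_* Y> for all Y. *)
Definition tangent_part u w : 'cV[R]_n :=
  invmx (g u) *m (jac F u)^T *m eta *m w.

(* Orthogonal projection onto N_fM: F is normal to the space form, and        *)
(* ct <F, F> = 1 if ct <> 0.                                                  *)
Definition normal_part u w : 'cV[R]_N :=
  w - jac F u *m tangent_part u w - (ct * ip w (F u)) *: F u.

Definition normal_vector u xi : Prop :=
  (forall X, ip xi (jac F u *m X) = 0) /\ ct * ip xi (F u) = 0.

Definition second_form u X Y : 'cV[R]_N := normal_part u ('D_X ('D_Y F) u).

Definition shape u xi X : 'cV[R]_n :=
  invmx (g u) *m
  \col_(l < n) ip (second_form u X (delta_mx l 0 : 'cV[R]_n)) xi.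

Definition normal_nabla X (xi : 'cV[R]_n -> 'cV[R]_N) u : 'cV[R]_N :=
  normal_part u ('D_X xi u).

(* V is Euclidean R^m. Elements of V are taken as constant sections of M x V, *)
(* so that nabla_X v = 0.                                                     *)
Section Ribaucour.
Variables (m : nat) (phi : 'cV[R]_n -> 'cV[R]_m).
Variables (beta : 'cV[R]_n -> 'M[R]_(N, m)) (Omega : 'cV[R]_n -> 'M[R]_m).
Implicit Types v : 'cV[R]_m.

Definition omega_t u : 'M[R]_(n, m) := invmx (g u) *m (jac phi u)^T.

Definition Phi u v X : 'cV[R]_n :=
  nabla g X (fun u' => omega_t u' *m v) u - shape u (beta u *m v) X
  + (ct * dot (phi u) v) *: X.

Definition calG u : 'M[R]_(N, m) :=
  jac F u *m omega_t u + beta u + ct *: (F u *m (phi u)^T).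

Definition calG_t u : 'M[R]_(m, N) := (calG u)^T *m eta.

Definition ribaucour_at u : Prop :=
  (forall v, normal_vector u (beta u *m v)) /\
  (forall X v, second_form u X (omega_t u *m v)
               + normal_nabla X (fun u' => beta u' *m v) u = 0) /\
  (forall v v' X, Phi u v (Phi u v' X) = Phi u v' (Phi u v X)) /\
  Omega u \in unitmx /\
  (forall X, 'D_X Omega u = calG_t u *m 'D_X calG u) /\
  Omega u + (Omega u)^T = calG_t u *m calG u.

Definition ribaucour_transform u : 'cV[R]_N :=
  F u - calG u *m invmx (Omega u) *m phi u.

Definition L_condition_at (c : R) (L : 'M[R]_m) u : Prop :=
  (forall v Y, Phi u (L *m v) Y + shape u (beta u *m v) Y
               + ((c - ct) * dot (phi u) v) *: Y = 0) /\
  Omega u *m L + L^T *m (Omega u)^T =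
    (beta u)^T *m eta *m beta u - (c - ct) *: (phi u *m (phi u)^T).

End Ribaucour.
End CoordinateImmersion.

Section Transforms.
Variables (n : nat) (ct : R) (M : smooth_manifold R n) (g : tensor2 M).
Implicit Types f ft : M -> 'cV[R]_N.

Definition isometric_immersion f : Prop :=
  [/\ smooth_map f,
      forall x, space_form ct (f x) &
      forall k u, atlas k -> chart_codom k u -> induced_metric f k u = g k u].

Definition is_ribaucour_transform (m : nat) (phi : M -> 'cV[R]_m)
    (beta : M -> 'M[R]_(N, m)) (Omega : M -> 'M[R]_m) f ft : Prop :=
  [/\ smooth_map phi, smooth_map beta, smooth_map Omega &
      forall k u, atlas k -> chart_codom k u ->
        ribaucour_at ct (g k) (f \o param k)
          (phi \o param k) (beta \o param k) (Omega \o param k) u /\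
        ft (param k u) = ribaucour_transform ct (g k) (f \o param k)
          (phi \o param k) (beta \o param k) (Omega \o param k) u].

Definition is_L_transform (c : R) f ft : Prop :=
  exists (m : nat) (phi : M -> 'cV[R]_m) (beta : M -> 'M[R]_(N, m))
         (Omega : M -> 'M[R]_m) (L : 'M[R]_m),
    is_ribaucour_transform phi beta Omega f ft /\
    forall k u, atlas k -> chart_codom k u ->
      L_condition_at ct (g k) (f \o param k)
        (phi \o param k) (beta \o param k) (Omega \o param k) c L u.

End Transforms.
End PseudoEuclidean.

(* The flat ambient space of the space form of dimension d and index s: one   *)
(* more dimension if ct <> 0, which is timelike if ct < 0.                    *)
Definition ambient_dim (R : realType) (d : nat) (ct : R) : nat :=
  (d + (ct != 0)%R)%N.

Definition ambient_index (R : realType) (s : nat) (ct : R) : nat :=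
  (s + (ct < 0)%R)%N.

(* Main.v *)
From mathcomp Require Import all_boot all_order all_algebra.
From mathcomp Require Import boolp classical_sets functions reals topology.
From mathcomp Require Import normedtype landau derive perm ring lra.
Require Import Defs.

(** The transform has constant curvature because of the Gauss equation, used
    twice: for the given immersion F and for its transform, both regarded as
    immersions in the flat ambient space.

    Work in a chart and write J for the Jacobian matrix of F, G for calG, and B
    for the second fundamental form of F in the flat ambient space. The
    conditions on beta say that d G (X) = J Phi(X): the derivative of G is
    tangent to f (derive_calG). Together with d Omega = G^t d G and
    d phi = G^t J this gives

      F~_* = P F_* D,   P = 1 - G Omega^-1 G^t,   D = 1 - Phi_(Omega^-1 phi),

    and Omega + Omega^t = G^t G makes P an isometry of the ambient space
    (ribaucour_P_isometry). The induced metric is therefore <D X, D Y>; it is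
    positive definite exactly where D is invertible, that is, at the regular
    points (gram_transform_posdef).

    Differentiating once more, P splits off again, and the second fundamental
    form of F~ is P nu(X, D Y) with

      nu(X, Z) = B(X, Z) + (beta + ct F phi^t) Omega^-t Phi(X)^t Z

    (normal_hessian_transform). The two conditions on L are what is needed to
    compute the products of these vectors (ip_pre_second_form):

      <nu(X, Z), nu(Y, V)> = <B(X, Z), B(Y, V)>
                             + c (<D X, Z> <D Y, V> - <X, Z> <Y, V>).

    Antisymmetrizing in X and Y and setting Z = D X, V = D Y, the terms in B
    are given by the Gauss equation of F. Since M has constant curvature c, they
    cancel the terms that come from c <X, Z> <Y, V>. There remains
    c (<D X, D X> <D Y, D Y> - <D X, D Y> ^ 2), which is the claim. The Gauss
    equation of F is needed here for four different vectors, whereas the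
    hypothesis is on sectional curvatures; polarization closes the gap.

    The Gauss equation itself (gauss_equation) is proved for Gram matrices of
    maps in a flat space. It needs the symmetry of second derivatives and the
    stability of smooth maps under products and inverses of matrices. *)

Set Implicit Arguments.
Unset Strict Implicit.
Unset Printing Implicit Defensive.
Import Order.TTheory GRing.Theory Num.Theory.
Import numFieldNormedType.Exports.
Local Open Scope classical_set_scope.
Local Open Scope ring_scope.

(** * Derivatives of matrix-valued maps *)

Section MatrixCalculus.
Variables (R : realType) (V : normedModType R).
Implicit Types (u v : V).

Lemma differentiable_bigsum (W : normedModType R) (I : Type) (r : seq I)
    (P : pred I) (f : I -> V -> W) u :
  (forall i, differentiable (f i) u) ->
  differentiable (fun w => \sum_(i <- r | P i) f i w) u.
Proof.
move=> df; elim: r => [|i r IH].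
  under [X in differentiable X _]eq_fun do rewrite big_nil.
  exact: differentiable_cst.
under [X in differentiable X _]eq_fun do rewrite big_cons.
case: (P i) => //.
exact: (@differentiableD _ _ _ (f i) (fun w => \sum_(i0 <- r | P i0) f i0 w)).
Qed.

Lemma differentiable_mxP a b (h : V -> 'M[R]_(a, b)) u :
  (forall i j, differentiable (fun w => h w i j : R) u) <-> differentiable h u.
Proof.
split=> [dh|dh i j]; last first.
  exact: (@differentiable_comp _ _ _ _ h (fun M : 'M[R]_(a, b) => M i j : R)
    u dh (differentiable_coord _ _ _)).
under [X in differentiable X _]eq_fun do rewrite [h _]matrix_sum_delta.
apply: differentiable_bigsum => i; apply: differentiable_bigsum => j.
exact: differentiableZl.
Qed.

Lemma derive_mxE a b (h : V -> 'M[R]_(a, b)) u v i j : differentiable h u ->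
  ('D_v h u) i j = 'D_v (fun w => h w i j : R) u.
Proof. by move=> dh; rewrite derive_mx ?mxE//; apply: diff_derivable. Qed.

Lemma differentiable_mulmx a b d (f : V -> 'M[R]_(a, b)) (h : V -> 'M[R]_(b, d)) u :
  differentiable f u -> differentiable h u ->
  differentiable (fun w => f w *m h w) u.
Proof.
move=> df dh; apply/differentiable_mxP => i j.
under [X in differentiable X _]eq_fun do rewrite mxE.
apply: differentiable_bigsum => k.
by apply: (@differentiableM _ _ (fun w => f w i k) (fun w => h w k j));
  apply: (proj2 (differentiable_mxP _ _)).
Qed.

Lemma derive_mulmx a b d (f : V -> 'M[R]_(a, b)) (h : V -> 'M[R]_(b, d)) u v :
  differentiable f u -> differentiable h u ->
  'D_v (fun w => f w *m h w) u = 'D_v f u *m h u + f u *m 'D_v h u.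
Proof.
move=> df dh; apply/matrixP => i j.
have dfe k l := proj2 (differentiable_mxP f u) df k l.
have dhe k l := proj2 (differentiable_mxP h u) dh k l.
rewrite derive_mxE; last exact: differentiable_mulmx.
pose fh k w : R := f w i k * h w k j.
have -> : (fun w => (f w *m h w) i j) = \sum_k fh k.
  by apply/funext => w; rewrite mxE fct_sumE.
rewrite derive_sum; last first.
  by move=> k; apply/diff_derivable/(@differentiableM _ _ (fun w => f w i k)
    (fun w => h w k j)); [apply: dfe|apply: dhe].
rewrite !mxE -big_split /=; apply: eq_bigr => k _.
rewrite (@deriveM _ _ (fun w => f w i k) (fun w => h w k j));
  [|exact: diff_derivable|exact: diff_derivable].
by rewrite (derive_mxE v i k df) (derive_mxE v k j dh) addrC; congr (_ + _);
  rewrite mulrC.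
Qed.

Lemma differentiable_trmx a b (h : V -> 'M[R]_(a, b)) u :
  differentiable h u -> differentiable (fun w => (h w)^T) u.
Proof.
move=> dh; apply/differentiable_mxP => i j.
under [X in differentiable X _]eq_fun do rewrite mxE.
exact: (proj2 (differentiable_mxP h u) dh).
Qed.

Lemma derive_trmx a b (h : V -> 'M[R]_(a, b)) u v : differentiable h u ->
  'D_v (fun w => (h w)^T) u = ('D_v h u)^T.
Proof.
move=> dh; apply/matrixP => i j.
rewrite derive_mxE; last exact: differentiable_trmx.
rewrite mxE derive_mxE//.
by congr ('D_v _ u); apply/funext => w; rewrite mxE.
Qed.

Lemma differentiable_prod (I : Type) (r : seq I) (P : pred I) (f : I -> V -> R) u :
  (forall i, differentiable (f i) u) ->
  differentiable (fun w => \prod_(i <- r | P i) f i w) u.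
Proof.
move=> df; elim: r => [|i r IH].
  under [X in differentiable X _]eq_fun do rewrite big_nil.
  exact: differentiable_cst.
under [X in differentiable X _]eq_fun do rewrite big_cons.
case: (P i) => //.
exact: (@differentiableM _ _ (f i) (fun w => \prod_(i0 <- r | P i0) f i0 w)).
Qed.

Lemma differentiable_det a (h : V -> 'M[R]_a) u :
  differentiable h u -> differentiable (fun w => \det (h w)) u.
Proof.
move=> dh; apply: differentiable_bigsum => s.
apply: (@differentiableM _ _ (fun=> (-1) ^+ s)
  (fun w => \prod_(i < a) h w i (s i))).
  exact: differentiable_cst.
apply: differentiable_prod => i.
exact: (proj2 (differentiable_mxP h u) dh).
Qed.

Lemma differentiable_adj a (h : V -> 'M[R]_a) u :
  differentiable h u -> differentiable (fun w => \adj (h w)) u.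
Proof.
move=> dh; apply/differentiable_mxP => i j.
under [X in differentiable X _]eq_fun do rewrite mxE.
apply: (@differentiableM _ _ (fun=> (-1) ^+ (j + i))
  (fun w => \det (row' j (col' i (h w))))).
  exact: differentiable_cst.
apply: differentiable_det; apply/differentiable_mxP => k l.
under [X in differentiable X _]eq_fun do rewrite !mxE.
exact: (proj2 (differentiable_mxP h u) dh).
Qed.

(** Invertibility is an open condition because it is the nonvanishing of the
    determinant, a continuous function of the entries. *)
Lemma near_unitmx a (h : V -> 'M[R]_a) u :
  differentiable h u -> h u \in unitmx -> \forall w \near u, h w \in unitmx.
Proof.
move=> dh uh; have cd := differentiable_continuous (differentiable_det dh).
have du : \det (h u) != 0 by rewrite -unitfE -unitmxE.
have nd : \forall w \near u, \det (h w) != 0 by exact: cvgr_neq0 cd du.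
apply: filterS nd => w.
by rewrite unitmxE unitfE.
Qed.

Lemma near_eq_differentiable (W : normedModType R) (f h : V -> W) u :
  (\forall w \near u, f w = h w) -> differentiable f u -> differentiable h u.
Proof.
move=> fh /diff_locallyP[cf /eqaddoP df].
have fhu : f u = h u by apply: (nbhs_singleton fh).
have eh : h \o shift u = cst (h u) + 'd f u +o_ 0 id.
  apply/eqaddoP => e e0; have := df e e0; rewrite near_simpl => dfe.
  near=> x.
  have -> : (h \o shift u - (cst (h u) + 'd f u)) x =
      (f \o shift u - (cst (f u) + 'd f u)) x.
    rewrite /GRing.add /GRing.opp /= -fhu; congr (_ - _); apply/esym.
    by near: x; rewrite near_simpl; have := fh; rewrite (near_shift 0) /= subr0; apply.
  by near: x.
have dhf : 'd h u = 'd f u :> (V -> W) by apply: diff_unique.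
by apply/diff_locallyP; rewrite dhf; split.
Unshelve. all: by end_near. Qed.

(** Near u the inverse is the adjugate divided by the determinant, and both are
    polynomials in the entries. *)
Lemma differentiable_invmx a (h : V -> 'M[R]_a) u :
  differentiable h u -> h u \in unitmx -> differentiable (fun w => invmx (h w)) u.
Proof.
move=> dh uh.
apply: (@near_eq_differentiable _ (fun w => (\det (h w))^-1 *: \adj (h w))).
  apply: filterS (near_unitmx dh uh) => w uw.
  by rewrite /invmx uw.
apply/differentiable_mxP => i j.
under [X in differentiable X _]eq_fun do rewrite mxE.
apply: (@differentiableM _ _ (fun w => (\det (h w))^-1) (fun w => \adj (h w) i j)).
  apply: differentiableV; first exact: differentiable_det.
  by rewrite -unitfE -unitmxE.
exact: (proj2 (differentiable_mxP _ u) (differentiable_adj dh)).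
Qed.

(** Differentiate the identity h *m invmx h = 1, which holds near u. *)
Lemma derive_invmx a (h : V -> 'M[R]_a) u v :
  differentiable h u -> h u \in unitmx ->
  'D_v (fun w => invmx (h w)) u = - (invmx (h u) *m 'D_v h u *m invmx (h u)).
Proof.
move=> dh uh.
have dih := differentiable_invmx dh uh.
have := derive_mulmx v dh dih.
have -> : 'D_v (fun w => h w *m invmx (h w)) u = 0.
  rewrite (@near_eq_derive _ _ _ _ (cst (1%:M : 'M[R]_a))) ?derive_cst//.
  by apply: filterS (near_unitmx dh uh) => w uw; rewrite mulmxV.
move/esym/eqP; rewrite addrC addr_eq0 => /eqP e.
by rewrite -[LHS](mulKmx uh) e mulmxN mulmxA.
Qed.

End MatrixCalculus.

(** * Symmetry of second derivatives *)

Section Schwarz.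
Variables (R : realType) (V : normedModType R).
Implicit Types (u v x y : V).

Lemma is_derive_line (h : V -> R) a x (s : R) : differentiable h (a + s *: x) ->
  is_derive s 1 (fun r : R => h (a + r *: x)) ('D_x h (a + s *: x)).
Proof.
move=> dh.
have dl : is_diff s (fun r : R => a + r *: x) (fun r => r *: x).
  have -> : (fun r : R => r *: x) = 0 + (fun r : R => r *: x).
    by apply/funext => r; rewrite /GRing.add /= add0r.
  exact: (@is_diffD _ _ _ (cst a) (fun r : R => r *: x)).
have df : differentiable (fun r : R => h (a + r *: x)) s.
  by apply: (differentiable_comp (f := fun r : R => a + r *: x) (g := h)).
apply: DeriveDef; first exact: diff_derivable.
rewrite deriveE// (diff_comp (f := fun r : R => a + r *: x) (g := h))//.
by rewrite /= diff_val scale1r -deriveE.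
Qed.

Lemma mvt_line (h : V -> R) a x (s : R) : 0 < s ->
  (forall r, 0 <= r <= s -> differentiable h (a + r *: x)) ->
  exists2 r, 0 <= r <= s & h (a + s *: x) - h a = 'D_x h (a + r *: x) * s.
Proof.
move=> s0 dh.
have dl r : 0 <= r <= s -> is_derive r 1 (fun r : R => h (a + r *: x)) ('D_x h (a + r *: x)).
  by move=> /dh; exact: is_derive_line.
have [| |r] := @MVT R (fun r : R => h (a + r *: x)) (fun r => 'D_x h (a + r *: x)) 0 s s0.
- by move=> r; rewrite in_itv /= => /andP[r0 rs]; apply: dl; rewrite !ltW.
- apply: derivable_within_continuous => r; rewrite in_itv /= => rs.
  by have [] := dl _ rs.
rewrite in_itv /= scale0r addr0 subr0 => /andP[r0 rs] e.
by exists r => //; rewrite !ltW.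
Qed.

Lemma box_nbhs (P : set V) u x y : nbhs u P ->
  exists2 r : R, 0 < r &
    forall s t, 0 <= s <= r -> 0 <= t <= r -> P (u + s *: x + t *: y).
Proof.
move=> /nbhs_ballP[e /= e0 Pe].
have c0 : 0 < `|x| + `|y| + 1 by rewrite ltr_wpDl// addr_ge0.
exists (e / (`|x| + `|y| + 1)); first by rewrite divr_gt0.
move=> s t /andP[s0 sr] /andP[t0 tr]; apply: Pe.
rewrite -ball_normE /ball_ /= -addrA opprD addrA subrr add0r normrN.
apply: le_lt_trans (ler_normD _ _) _; rewrite !normrZ !ger0_norm//.
apply: (@le_lt_trans _ _ (e / (`|x| + `|y| + 1) * (`|x| + `|y|))).
  by rewrite mulrDr lerD// ler_wpM2r.
by rewrite -mulrA gtr_pMr// mulrC ltr_pdivrMr// mul1r ltrDl.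
Qed.

(** Two applications of the mean value theorem, first along x and then along y,
    express the second difference of h over the parallelogram spanned by r x and
    r y. The left-hand side does not change when x and y are exchanged, which is
    what makes the mixed derivatives agree in the limit. *)
Lemma mixed_derivative_mvt (h : V -> R) u x y (P : set V) : nbhs u P ->
  (\forall w \near u, differentiable h w) ->
  (\forall w \near u, differentiable ('D_x h) w) ->
  exists2 r : R, 0 < r & forall r', 0 < r' <= r -> exists2 w, P w &
    h (u + r' *: x + r' *: y) - h (u + r' *: x) - (h (u + r' *: y) - h u) =
    'D_y ('D_x h) w * r' * r'.
Proof.
move=> Pu dh dxh.
have /(@box_nbhs _ _ x y)[r r0 H] : nbhs u (P `&` [set w | differentiable h w]
   `&` [set w | differentiable ('D_x h) w]).
  by apply: filterI => //; apply: filterI.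
exists r => // q /andP[q0 qr].
have Hq s t : 0 <= s <= q -> 0 <= t <= q ->
    [/\ P (u + s *: x + t *: y), differentiable h (u + s *: x + t *: y)
      & differentiable ('D_x h) (u + s *: x + t *: y)].
  move=> /andP[s0 sq] /andP[t0 tq].
  have [||[? ?] ?] := H s t; rewrite ?s0 ?t0 ?(le_trans sq) ?(le_trans tq)//.
have z0q : (0 : R) <= 0 <= q by rewrite lexx ltW.
have qq : 0 <= q <= q by rewrite lexx ltW.
pose k := fun w => h (w + q *: y) - h w.
have dk s : 0 <= s <= q -> is_derive (u + s *: x) x k
    ('D_x h (u + s *: x + q *: y) - 'D_x h (u + s *: x)) /\
    differentiable k (u + s *: x).
  move=> sq; have [_ d1 _] := Hq s q sq qq.
  have [_ d0 _] := Hq s 0 sq z0q; rewrite scale0r addr0 in d0.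
  have ds : is_diff (u + s *: x) (fun w => w + q *: y) (fun w => w).
    have -> : (fun w : V => w) = (fun w : V => w) + 0.
      by apply/funext => w; rewrite /GRing.add /= addr0.
    exact: (@is_diffD _ _ _ id (cst (q *: y))).
  have dd : differentiable (fun w => h (w + q *: y)) (u + s *: x).
    by apply: (differentiable_comp (f := fun w => w + q *: y) (g := h)).
  split; last exact: (differentiableB (f := fun w => h (w + q *: y)) (g := h)).
  apply: (@is_deriveB _ _ _ (fun w => h (w + q *: y)) h).
    apply: DeriveDef; first exact: diff_derivable.
    rewrite deriveE// (diff_comp (f := fun w => w + q *: y) (g := h))//=.
    by rewrite diff_val -deriveE.
  by apply: DeriveDef => //; exact: diff_derivable.
have [s sq e1] := mvt_line q0 (fun s sq => (dk s sq).2).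
have [t tq e2] := @mvt_line ('D_x h) (u + s *: x) y q q0
  (fun t tq => let: And3 _ _ d := Hq s t sq tq in d).
exists (u + s *: x + t *: y); first by have [] := Hq s t sq tq.
have [[_ dks] _] := dk s sq.
by rewrite -e2 -dks -e1 /k.
Qed.

(** For every small r the two mixed derivatives, taken at two points near u, are
    equal: both are the second difference divided by r ^ 2. Continuity at u then
    makes their difference at u as small as desired. *)
Lemma derive_sym_real (h : V -> R) u x y :
  (\forall w \near u, differentiable h w) ->
  (\forall w \near u, differentiable ('D_x h) w) ->
  (\forall w \near u, differentiable ('D_y h) w) ->
  {for u, continuous ('D_y ('D_x h))} -> {for u, continuous ('D_x ('D_y h))} ->
  'D_x ('D_y h) u = 'D_y ('D_x h) u.
Proof.
move=> dh dx dy cyx cxy; apply/eqP; rewrite -subr_eq0 -normr_le0.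
apply/ler_addgt0Pl => e e0; rewrite addr0.
have e2 : 0 < e / 2 by rewrite divr_gt0.
have nyx : \forall w \near u, `|'D_y ('D_x h) u - 'D_y ('D_x h) w| <= e / 2.
  exact: (cvgrPdist_le _ _).1 cyx _ e2.
have nxy : \forall w \near u, `|'D_x ('D_y h) u - 'D_x ('D_y h) w| <= e / 2.
  exact: (cvgrPdist_le _ _).1 cxy _ e2.
have [r r0 H1] := mixed_derivative_mvt y nyx dh dx.
have [r' r'0 H2] := mixed_derivative_mvt x nxy dh dy.
pose q := Num.min r r'.
have q0 : 0 < q by rewrite lt_min r0.
have [|w /= Hw ew] := H1 q; first by rewrite q0 ge_min lexx.
have [|w' /= Hw' ew'] := H2 q; first by rewrite q0 ge_min lexx orbT.
have eq : 'D_y ('D_x h) w = 'D_x ('D_y h) w'.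
  have swap (a b c d : R) : a - b - (c - d) = a - c - (b - d) by ring.
  apply: (mulIf (lt0r_neq0 q0)); apply: (mulIf (lt0r_neq0 q0)).
  apply: etrans (esym ew) (etrans _ ew').
  by rewrite [u + q *: y + q *: x]addrAC; exact: swap.
have triangle (a a' b b' : R) : b' = a' -> `|a - a'| <= e / 2 ->
    `|b - b'| <= e / 2 -> `|a - b| <= e.
  move=> -> ha hb; rewrite -(subrKA a') (splitr e).
  by apply: le_trans (ler_normD _ _) (lerD ha _); rewrite distrC.
exact: triangle eq Hw' Hw.
Qed.

End Schwarz.

(** * Smooth maps on an open set *)

Section Smooth.
Variables (R : realType) (n : nat) (A : set 'cV[R]_n).
Hypothesis oA : open A.

(** The continuity clause of the class C^k is left out, as differentiability at
    the next order implies it: induction on k in the closure properties below then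
    starts from a trivial case. *)
Fixpoint diffk (W : normedModType R) (k : nat) (h : 'cV[R]_n -> W) : Prop :=
  if k is k'.+1 then
    (forall u, A u -> differentiable h u) /\
    (forall v : 'cV[R]_n, diffk k' ('D_v h))
  else True.

Lemma smooth_diffkP (W : normedModType R) (h : 'cV[R]_n -> W) :
  smooth_on A h <-> forall k, diffk k h.
Proof.
split=> [sh k|dh k].
  move: (sh k); elim: k h {sh} => [|k IH] h //= [dh Dh]; split=> // v.
  exact/IH/Dh.
move: (dh k.+1) => {dh}; elim: k h => [|k IH] h /= [dh Dh].
  by move=> u Au; apply: differentiable_continuous; apply: dh.
by split=> // v; apply/IH/Dh.
Qed.

Lemma diffkW (W : normedModType R) k (h : 'cV[R]_n -> W) :
  diffk k.+1 h -> diffk k h.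
Proof.
elim: k h => [|k IH] h // [dh Dh]; split=> // v; exact/IH/Dh.
Qed.

Lemma near_open u : A u -> \forall w \near u, A w.
Proof. by move=> Au; apply: open_nbhs_nbhs. Qed.

Lemma derive_eq_on (W : normedModType R) (f h : 'cV[R]_n -> W) u v :
  (forall w, A w -> f w = h w) -> A u -> 'D_v f u = 'D_v h u.
Proof.
move=> fh Au; apply: near_eq_derive; apply: filterS (near_open Au) => w; exact: fh.
Qed.

Lemma differentiable_eq_on (W : normedModType R) (f h : 'cV[R]_n -> W) u :
  (forall w, A w -> f w = h w) -> A u -> differentiable f u -> differentiable h u.
Proof.
move=> fh Au; apply: near_eq_differentiable.
apply: filterS (near_open Au) => w; exact: fh.
Qed.

Lemma diffk_eq (W : normedModType R) k (f h : 'cV[R]_n -> W) :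
  (forall w, A w -> f w = h w) -> diffk k f -> diffk k h.
Proof.
elim: k f h => [|k IH] f h //= fh [df Df]; split=> [u Au|v].
  by apply: (differentiable_eq_on fh) => //; apply: df.
by apply: (IH ('D_v f)) => // w Aw; apply: derive_eq_on.
Qed.

Lemma smooth_diff (W : normedModType R) (h : 'cV[R]_n -> W) u :
  smooth_on A h -> A u -> differentiable h u.
Proof. by move=> /(_ 1%N)[dh _]; apply: dh. Qed.

Lemma smooth_D (W : normedModType R) (h : 'cV[R]_n -> W) v :
  smooth_on A h -> smooth_on A ('D_v h).
Proof. by move=> sh k; have [_] := sh k.+1; apply. Qed.

Lemma smooth_eq (W : normedModType R) (f h : 'cV[R]_n -> W) :
  (forall w, A w -> f w = h w) -> smooth_on A f -> smooth_on A h.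
Proof.
move=> fh /smooth_diffkP sf; apply/smooth_diffkP => k; exact: diffk_eq (sf k).
Qed.

Lemma diffk_cst (W : normedModType R) k (c : W) : diffk k (fun=> c).
Proof.
elim: k c => [|k IH] c //=; split=> [u _|v]; first exact: differentiable_cst.
apply: (@diffk_eq _ _ (fun=> 0)) => // w _.
by rewrite (derive_cst c).
Qed.

Lemma smooth_cst (W : normedModType R) (c : W) : smooth_on A (fun=> c).
Proof. by apply/smooth_diffkP => k; exact: diffk_cst. Qed.

Lemma derive_add (W : normedModType R) (f h : 'cV[R]_n -> W) u v :
  differentiable f u -> differentiable h u ->
  'D_v (fun w => f w + h w) u = 'D_v f u + 'D_v h u.
Proof. by move=> df dh; rewrite (@deriveD _ _ _ f h) //; apply: diff_derivable. Qed.

Lemma derive_opp (W : normedModType R) (f : 'cV[R]_n -> W) u v :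
  differentiable f u -> 'D_v (fun w => - f w) u = - 'D_v f u.
Proof. by move=> df; rewrite (@deriveN _ _ _ f) //; apply: diff_derivable. Qed.

Lemma derive_scale (W : normedModType R) (c : R) (f : 'cV[R]_n -> W) u v :
  differentiable f u -> 'D_v (fun w => c *: f w) u = c *: 'D_v f u.
Proof. by move=> df; rewrite (@deriveZ _ _ _ f) //; apply: diff_derivable. Qed.

Lemma diffkD (W : normedModType R) k (f h : 'cV[R]_n -> W) :
  diffk k f -> diffk k h -> diffk k (fun w => f w + h w).
Proof.
elim: k f h => [|k IH] f h //= [df Df] [dh Dh].
split=> [u Au|v]; first by apply: (differentiableD (df u Au) (dh u Au)).
apply: diffk_eq (IH _ _ (Df v) (Dh v)) => w Aw /=.
by rewrite derive_add//; [apply: df|apply: dh].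
Qed.

Lemma diffkN (W : normedModType R) k (f : 'cV[R]_n -> W) :
  diffk k f -> diffk k (fun w => - f w).
Proof.
elim: k f => [|k IH] f //= [df Df].
split=> [u Au|v]; first by apply: (differentiableN (df u Au)).
apply: diffk_eq (IH _ (Df v)) => w Aw /=.
by rewrite derive_opp//; apply: df.
Qed.

Lemma smooth_add (W : normedModType R) (f h : 'cV[R]_n -> W) :
  smooth_on A f -> smooth_on A h -> smooth_on A (fun w => f w + h w).
Proof.
move=> /smooth_diffkP sf /smooth_diffkP sh; apply/smooth_diffkP => k.
exact: diffkD.
Qed.

Lemma smooth_sub (W : normedModType R) (f h : 'cV[R]_n -> W) :
  smooth_on A f -> smooth_on A h -> smooth_on A (fun w => f w - h w).
Proof.
move=> sf /smooth_diffkP sh; apply: smooth_add => //.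
by apply/smooth_diffkP => k; apply: diffkN.
Qed.

Lemma smooth_scale (W : normedModType R) (c : R) (f : 'cV[R]_n -> W) :
  smooth_on A f -> smooth_on A (fun w => c *: f w).
Proof.
move=> /smooth_diffkP sf; apply/smooth_diffkP => k.
move: (sf k) => {sf}; elim: k f => [|k IH] f //= [df Df].
split=> [u Au|v]; first exact: (@differentiableZ _ _ _ f c u (df u Au)).
apply: diffk_eq (IH _ (Df v)) => w Aw /=.
by rewrite derive_scale//; apply: df.
Qed.

Lemma diffkM a b d k (f : 'cV[R]_n -> 'M[R]_(a, b)) (h : 'cV[R]_n -> 'M[R]_(b, d)) :
  diffk k f -> diffk k h -> diffk k (fun w => f w *m h w).
Proof.
elim: k f h => [|k IH] f h // df dh.
have [df1 Df] := df; have [dh1 Dh] := dh.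
split=> [u Au|v]; first by apply: differentiable_mulmx; [apply: df1|apply: dh1].
apply: (@diffk_eq _ _ (fun w => 'D_v f w *m h w + f w *m 'D_v h w)) => [w Aw|].
  by rewrite derive_mulmx//; [apply: df1|apply: dh1].
apply: diffkD; apply: IH; [exact: Df|exact: diffkW|exact: diffkW|exact: Dh].
Qed.

Lemma smooth_mul a b d (f : 'cV[R]_n -> 'M[R]_(a, b)) (h : 'cV[R]_n -> 'M[R]_(b, d)) :
  smooth_on A f -> smooth_on A h -> smooth_on A (fun w => f w *m h w).
Proof.
move=> /smooth_diffkP sf /smooth_diffkP sh; apply/smooth_diffkP => k.
exact: diffkM.
Qed.

Lemma smooth_tr a b (f : 'cV[R]_n -> 'M[R]_(a, b)) :
  smooth_on A f -> smooth_on A (fun w => (f w)^T).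
Proof.
move=> /smooth_diffkP sf; apply/smooth_diffkP => k.
move: (sf k) => {sf}; elim: k f => [|k IH] f //= [df Df].
split=> [u Au|v]; first exact/differentiable_trmx/df.
by apply: diffk_eq (IH _ (Df v)) => w Aw /=; rewrite derive_trmx//; apply: df.
Qed.

(** The derivative of an inverse is a product of inverses and of a derivative, so
    that one more order of differentiability follows from the previous one. *)
Lemma smooth_inv a (f : 'cV[R]_n -> 'M[R]_a) :
  (forall u, A u -> f u \in unitmx) ->
  smooth_on A f -> smooth_on A (fun w => invmx (f w)).
Proof.
move=> fu /smooth_diffkP sf; apply/smooth_diffkP => k.
elim: k => [|k IH] //; have [df Df] := sf k.+1.
split=> [u Au|v]; first by apply: differentiable_invmx; [apply: df|apply: fu].
apply: (@diffk_eq _ _ (fun w => - (invmx (f w) *m 'D_v f w *m invmx (f w)))).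
  by move=> w Aw; rewrite derive_invmx//; [apply: df|apply: fu].
apply/diffkN/diffkM; last exact: IH.
by apply: diffkM; [exact: IH|exact: Df].
Qed.

Lemma jacE m (h : 'cV[R]_n -> 'cV[R]_m) u :
  jac h u = \sum_(i < n) 'D_(delta_mx i 0) h u *m (delta_mx 0 i : 'rV[R]_n).
Proof.
apply/matrixP => k l; rewrite mxE summxE (bigD1 l)//= big1 ?addr0.
  by rewrite mxE big_ord1 mxE !eqxx mulr1.
by move=> j jl; rewrite mxE big_ord1 mxE eqxx eq_sym (negPf jl) mulr0.
Qed.

(** A differential is linear, hence determined by the partial derivatives. *)
Lemma jac_mulE m (h : 'cV[R]_n -> 'cV[R]_m) u X : differentiable h u ->
  jac h u *m X = 'D_X h u.
Proof.
move=> dh; rewrite deriveE// jacE mulmx_suml.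
rewrite {2}(matrix_sum_delta X) linear_sum; apply: eq_bigr => i _.
rewrite big_ord1 linearZ/= deriveE// -mulmxA.
have -> : (delta_mx 0 i : 'rV[R]_n) *m X = (X i 0)%:M.
  apply/matrixP => k l; rewrite !ord1 mxE (bigD1 i)//= big1 ?addr0.
    by rewrite !mxE !eqxx mul1r.
  by move=> j ji; rewrite mxE eqxx (negPf ji) mul0r.
by rewrite mul_mx_scalar.
Qed.

Lemma smooth_jac m (h : 'cV[R]_n -> 'cV[R]_m) :
  smooth_on A h -> smooth_on A (jac h).
Proof.
move=> sh; apply: (@smooth_eq _ (fun u => \sum_(i < n) 'D_(delta_mx i 0) h u
    *m (delta_mx 0 i : 'rV[R]_n))) => [w _|]; first by rewrite jacE.
elim: (index_enum _) => [|i r IH].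
  by apply: (@smooth_eq _ (fun=> 0)) (smooth_cst _) => w _; rewrite big_nil.
apply: (@smooth_eq _ _ _ _ (smooth_add (smooth_mul (smooth_D (delta_mx i 0) sh)
  (smooth_cst (delta_mx 0 i : 'rV[R]_n))) IH)) => w _ /=.
by rewrite big_cons.
Qed.

Lemma derive_jac m (h : 'cV[R]_n -> 'cV[R]_m) u X Y : smooth_on A h -> A u ->
  'D_X ('D_Y h) u = 'D_X (jac h) u *m Y.
Proof.
move=> sh Au.
rewrite (@derive_eq_on _ ('D_Y h) (fun w => jac h w *m Y))//; last first.
  by move=> w Aw; rewrite jac_mulE//; apply: smooth_diff.
rewrite derive_mulmx; first by rewrite (derive_cst Y) mulmx0 addr0.
  by apply: smooth_diff => //; apply: smooth_jac.
exact: differentiable_cst.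
Qed.

(** Schwarz's theorem is applied entry by entry. *)
Lemma derive_sym a b (h : 'cV[R]_n -> 'M[R]_(a, b)) u X Y :
  smooth_on A h -> A u -> 'D_X ('D_Y h) u = 'D_Y ('D_X h) u.
Proof.
move=> sh Au; apply/matrixP => i j.
have entry (f : 'cV[R]_n -> 'M[R]_(a, b)) w : smooth_on A f -> A w ->
    differentiable (fun w => f w i j : R) w.
  by move=> sf Aw; apply: (proj2 (differentiable_mxP _ _)); apply: smooth_diff.
have DE (f : 'cV[R]_n -> 'M[R]_(a, b)) Z w : smooth_on A f -> A w ->
    'D_Z f w i j = 'D_Z (fun w => f w i j : R) w.
  by move=> sf Aw; rewrite derive_mxE//; apply: smooth_diff.
have dD Z w : A w -> differentiable ('D_Z (fun w => h w i j : R)) w.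
  move=> Aw; apply: (@differentiable_eq_on _ (fun w => 'D_Z h w i j : R)) => //.
    by move=> ? ?; rewrite DE.
  by apply: entry => //; apply: smooth_D.
have DDE Z Z' w : A w -> 'D_Z ('D_Z' h) w i j = 'D_Z ('D_Z' (fun w => h w i j : R)) w.
  move=> Aw; rewrite DE//; last exact: smooth_D.
  by apply: derive_eq_on => // ? ?; rewrite DE.
have cDD Z Z' : {for u, continuous ('D_Z ('D_Z' (fun w => h w i j : R)))}.
  apply: (@differentiable_continuous _ _ _ u).
  apply: (@differentiable_eq_on _ (fun w => 'D_Z ('D_Z' h) w i j : R)) => //.
    by move=> ? ?; rewrite DDE.
  by apply: entry => //; do 2 apply: smooth_D.
apply: etrans (DDE X Y u Au) (etrans _ (esym (DDE Y X u Au))).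
apply: derive_sym_real; [ | | |exact: cDD|exact: cDD].
- by apply: filterS (near_open Au) => w Aw; apply: entry.
- by apply: filterS (near_open Au) => w Aw; apply: dD.
- by apply: filterS (near_open Au) => w Aw; apply: dD.
Qed.

End Smooth.

Lemma smooth_subset (R : realType) n (W : normedModType R) (A B : set 'cV[R]_n)
    (h : 'cV[R]_n -> W) : B `<=` A -> smooth_on A h -> smooth_on B h.
Proof.
move=> BA sh k; elim: k h {sh}(sh k) => [|k IH] h /=; first by move=> ch u /BA; exact: ch.
by move=> [dh Dh]; split=> [u /BA|v]; [exact: dh|exact/IH/Dh].
Qed.

(** * Bilinear forms given by matrices *)

Section Forms.
Variable R : realType.

Section Form.
Variables (m : nat) (A : 'M[R]_m).
Implicit Types x y z : 'cV[R]_m.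

Lemma formDl x y z : form A (x + y) z = form A x z + form A y z.
Proof. by rewrite /form linearD/= !mulmxDl mxE. Qed.
Lemma formDr x y z : form A z (x + y) = form A z x + form A z y.
Proof. by rewrite /form !mulmxDr mxE. Qed.
Lemma formZl k x y : form A (k *: x) y = k * form A x y.
Proof. by rewrite /form linearZ/= -!scalemxAl mxE. Qed.
Lemma formZr k x y : form A x (k *: y) = k * form A x y.
Proof. by rewrite /form -!scalemxAr mxE. Qed.
Lemma formNl x y : form A (- x) y = - form A x y.
Proof. by rewrite -scaleN1r formZl mulN1r. Qed.
Lemma formNr x y : form A x (- y) = - form A x y.
Proof. by rewrite -scaleN1r formZr mulN1r. Qed.
Lemma form0l y : form A 0 y = 0.
Proof. by rewrite -(scale0r 0) formZl mul0r. Qed.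
Lemma form0r y : form A y 0 = 0.
Proof. by rewrite -(scale0r 0) formZr mul0r. Qed.

Lemma form_sym x y : A^T = A -> form A x y = form A y x.
Proof.
move=> sA; rewrite /form -[in LHS](trmxK (x^T *m A *m y)) mxE.
by rewrite !trmx_mul trmxK sA mulmxA.
Qed.

Lemma form_inj x y : (forall z, form A z x = form A z y) -> A *m x = A *m y.
Proof.
move=> e; apply/colP => i; have := e (delta_mx i 0).
rewrite /form trmx_delta -!mulmxA.
by rewrite -!rowE !mxE.
Qed.

End Form.

Lemma form_mul k m (A : 'M[R]_m) (B : 'M[R]_(m, k)) x y :
  form (B^T *m A *m B) x y = form A (B *m x) (B *m y).
Proof. by rewrite /form trmx_mul !mulmxA. Qed.

(** The B-adjoint of y is the vector z given by g z = B^T A y. *)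
Lemma form_adj k m (A : 'M[R]_m) (g : 'M[R]_k) (B : 'M[R]_(m, k)) (x : 'cV[R]_k)
    (y : 'cV[R]_m) (z : 'cV[R]_k) :
  g *m z = B^T *m A *m y -> form g x z = form A (B *m x) y.
Proof. by move=> e; rewrite /form trmx_mul -mulmxA e !mulmxA. Qed.

Variables (N nu : nat).

Lemma eta_sym : (eta R N nu)^T = eta R N nu.
Proof. exact: tr_diag_mx. Qed.

Lemma ip_sym (x y : 'cV[R]_N) : ip nu x y = ip nu y x.
Proof. exact/form_sym/eta_sym. Qed.

Lemma gram_sym n (F : 'cV[R]_n -> 'cV[R]_N) u : (gram nu F u)^T = gram nu F u.
Proof. by rewrite /gram !trmx_mul trmxK eta_sym mulmxA. Qed.

End Forms.

(** * The Gauss equation of an immersion in a flat space *)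

(** The algebra behind the Gauss equation. Here j is the Jacobian matrix of an
    immersion, DX, DY, DXY, DYX are its first and second derivatives, GY and GX are
    the Christoffel vectors of (Y, Z) and (X, Z) with derivatives dGY along X and
    dGX along Y, and GXY, GYX are the Christoffel vectors of (X, GY) and (Y, GX).
    The terms with second derivatives of j cancel. *)
Lemma curvature_matrix_identity (R : realType) (N n : nat) (E : 'M[R]_N)
    (gu : 'M[R]_n) (j DX DY DXY DYX : 'M[R]_(N, n))
    (Z GY GX GXY GYX dGY dGX : 'cV[R]_n) :
  gu *m dGY = DX^T *m E *m (DY *m Z) + j^T *m E *m (DXY *m Z) -
    (DX^T *m E *m j + j^T *m E *m DX) *m GY ->
  gu *m dGX = DY^T *m E *m (DX *m Z) + j^T *m E *m (DYX *m Z) -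
    (DY^T *m E *m j + j^T *m E *m DY) *m GX ->
  DXY = DYX ->
  gu *m GXY = j^T *m E *m (DX *m GY) ->
  gu *m GYX = j^T *m E *m (DY *m GX) ->
  gu *m (dGY + GXY - (dGX + GYX)) =
  DX^T *m E *m (DY *m Z - j *m GY) - DY^T *m E *m (DX *m Z - j *m GX).
Proof.
move=> kY kX eXY gXY gYX.
rewrite mulmxBr !mulmxDr kY kX gYX gXY eXY !mulmxN !mulmxDl !mulmxA.
rewrite !opprD !addrA !opprK.
by apply/matrixP => a b; rewrite !mxE; ring.
Qed.

Section GaussEquation.
Variables (R : realType) (N nu n : nat) (A : set 'cV[R]_n).
Variables (g : 'cV[R]_n -> 'M[R]_n) (H : 'cV[R]_n -> 'cV[R]_N).
Hypothesis oA : open A.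
Hypothesis sH : smooth_on A H.
Hypothesis gE : forall u, A u -> g u = gram nu H u.
Hypothesis gU : forall u, A u -> g u \in unitmx.

Local Notation J := (jac H).
Local Notation eta := (eta R N nu).
Local Notation "'DJ_' X u" := ('D_X (jac H) u) (at level 10, X at level 8, u at level 8).

Let sJ : smooth_on A J. Proof. exact: smooth_jac. Qed.
Let dJ u : A u -> differentiable J u. Proof. by move=> Au; apply: smooth_diff sJ Au. Qed.

Lemma gram_smooth : smooth_on A g.
Proof.
apply: (@smooth_eq _ _ _ oA _ (gram nu H)) => [w Aw|]; first by rewrite gE.
apply: smooth_mul => //; apply: smooth_mul => //; first exact: smooth_tr.
exact: smooth_cst.
Qed.

Lemma derive_gram u X : A u ->
  'D_X g u = (DJ_ X u)^T *m eta *m J u + (J u)^T *m eta *m DJ_ X u.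
Proof.
move=> Au; have dj := dJ Au.
rewrite (derive_eq_on oA (f := g) (h := fun w => (J w)^T *m eta *m J w))//.
have dt := differentiable_trmx dj.
have dc : differentiable (fun _ : 'cV[R]_n => eta) u by exact: differentiable_cst.
rewrite derive_mulmx//; last exact: differentiable_mulmx.
rewrite derive_mulmx//.
by rewrite derive_trmx// (derive_cst eta) mulmx0 addr0.
Qed.

Lemma hessian_sym u X Y : A u -> DJ_ X u *m Y = DJ_ Y u *m X.
Proof.
move=> Au; apply: etrans (esym (derive_jac oA X Y sH Au)) _.
exact: etrans (derive_sym oA X Y sH Au) (derive_jac oA Y X sH Au).
Qed.

Lemma derive_sum_delta (W : normedModType R) (h : 'cV[R]_n -> W) u Z :
  differentiable h u ->
  'D_Z h u = \sum_(l < n) Z l 0 *: 'D_(delta_mx l 0 : 'cV[R]_n) h u.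
Proof.
move=> dh; rewrite deriveE// {1}(matrix_sum_delta Z) linear_sum.
by apply: eq_bigr => l _; rewrite big_ord1 linearZ/= deriveE.
Qed.

(** The Koszul formula, in which the coordinate vectors e_l are replaced by any Z
    because D_Z g is linear in Z. *)
Lemma christoffel_form u X Y Z : A u ->
  2 * form (g u) Z (christoffel g u X Y) =
  form ('D_X g u) Z Y + form ('D_Y g u) Z X - form ('D_Z g u) X Y.
Proof.
move=> Au; rewrite /christoffel {1}/form -!scalemxAr [X in _ * X]mxE.
rewrite [Z^T *m _ *m (invmx _ *m _)]mulmxA mulmxK ?gU// mulrA divff ?mul1r ?pnatr_eq0//.
rewrite mulmxBr mulmxDr mxE [X in X + _]mxE !mulmxA [X in _ + X]mxE.
rewrite {1 2}/form; congr (_ + _ - _).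
rewrite (derive_sum_delta _ (smooth_diff gram_smooth Au)).
rewrite /form mulmx_sumr mulmx_suml summxE mxE; apply: eq_bigr => l _.
by rewrite -scalemxAr -scalemxAl !mxE.
Qed.

(** The Koszul formula reduces to a single term: the derivatives of a Gram matrix
    are sums of products of first and second derivatives of H, and the latter are
    symmetric. Thus the Levi-Civita connection is the tangent part of the flat one. *)
Lemma gram_christoffel u X Y : A u ->
  g u *m christoffel g u X Y = (J u)^T *m eta *m (DJ_ X u *m Y).
Proof.
move=> Au.
have -> : (J u)^T *m eta *m (DJ_ X u *m Y) =
    g u *m (invmx (g u) *m ((J u)^T *m eta *m (DJ_ X u *m Y))).
  by rewrite mulKVmx ?gU.
apply: form_inj => Z.
apply: (@mulfI _ 2); first by rewrite pnatr_eq0.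
rewrite christoffel_form// !derive_gram//.
rewrite (@form_adj _ _ _ eta (g u) (J u) Z (DJ_ X u *m Y)); last first.
  by rewrite mulKVmx ?gU.
have formDm (B C : 'M[R]_n) x y : form (B + C) x y = form B x y + form C x y.
  by rewrite /form mulmxDr mulmxDl mxE.
have f1 (B C : 'M[R]_(N, n)) x y : form (B^T *m eta *m C) x y = form eta (B *m x) (C *m y).
  by rewrite /form trmx_mul !mulmxA.
move: (hessian_sym Z Y Au) (hessian_sym Z X Au) (hessian_sym Y X Au).
move: (DJ_ X u) (DJ_ Y u) (DJ_ Z u) => DX DY DZ eZY eZX eYX.
rewrite !formDm !f1 eZY eZX eYX.
rewrite (form_sym (J u *m X) (DY *m Z)) ?eta_sym//.
ring.
Qed.

(** The second fundamental form of H as an immersion in the flat ambient space.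
    For an immersion in a space form it is the second fundamental form alpha
    followed by the umbilical term - ct <X, Y> F. *)
Definition normal_hessian (u X Y : 'cV[R]_n) : 'cV[R]_N :=
  DJ_ X u *m Y - J u *m christoffel g u X Y.

Lemma normal_hessian_normal u X Y : A u ->
  (J u)^T *m eta *m normal_hessian u X Y = 0.
Proof.
move=> Au; rewrite /normal_hessian mulmxBr -gram_christoffel// mulmxA.
by rewrite (gE Au) /gram subrr.
Qed.

Lemma christoffel_diff u X Y : A u -> differentiable (fun w => christoffel g w X Y) u.
Proof.
move=> Au; apply: (differentiable_eq_on oA (f := fun w =>
   invmx (g w) *m ((J w)^T *m eta *m (DJ_ X w *m Y)))) => //.
  by move=> w Aw; rewrite -gram_christoffel// mulKmx ?gU.
have dt := differentiable_trmx (dJ Au).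
have cd (a b : nat) (c : 'M[R]_(a, b)) : differentiable (fun _ : 'cV[R]_n => c) u.
  exact: differentiable_cst.
apply: differentiable_mulmx.
  by apply: differentiable_invmx; [exact: smooth_diff gram_smooth Au|exact: gU].
apply: differentiable_mulmx; first exact: differentiable_mulmx.
by apply: differentiable_mulmx => //; apply: smooth_diff Au; apply: smooth_D.
Qed.

(** Differentiate gram_christoffel once more: the tangent parts cancel and only
    products of second derivatives with normal vectors remain. *)
Lemma curvatureE u X Y Z : A u ->
  g u *m curvature g u X Y Z =
  (DJ_ X u)^T *m eta *m normal_hessian u Y Z -
  (DJ_ Y u)^T *m eta *m normal_hessian u X Z.
Proof.
move=> Au.
have cd (a b : nat) (c : 'M[R]_(a, b)) : differentiable (fun _ : 'cV[R]_n => c) u.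
  exact: differentiable_cst.
have nablaE Y' : nabla g Y' (fun=> Z) = (fun w => christoffel g w Y' Z).
  by apply/funext => w; rewrite /nabla (derive_cst Z) add0r.
have key X' Y' : g u *m 'D_X' (fun w => christoffel g w Y' Z) u =
    (DJ_ X' u)^T *m eta *m (DJ_ Y' u *m Z) +
    (J u)^T *m eta *m ('D_X' ('D_Y' (jac H)) u *m Z) -
    ((DJ_ X' u)^T *m eta *m J u + (J u)^T *m eta *m DJ_ X' u)
      *m christoffel g u Y' Z.
  have dg : differentiable g u by apply: smooth_diff gram_smooth Au.
  have dc := christoffel_diff Y' Z Au.
  have dt := differentiable_trmx (dJ Au).
  have ddJ : differentiable ('D_Y' (jac H)) u by apply: smooth_diff Au; apply: smooth_D.
  have := derive_mulmx X' dg dc.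
  rewrite derive_gram// => e; apply: (canRL (addrK _)); rewrite addrC -e.
  rewrite (derive_eq_on oA (f := fun w => g w *m christoffel g w Y' Z)
     (h := fun w => (J w)^T *m eta *m (DJ_ Y' w *m Z)))//; last first.
    by move=> w Aw; rewrite gram_christoffel.
  rewrite derive_mulmx//; [|exact: differentiable_mulmx|exact: differentiable_mulmx].
  rewrite derive_mulmx// derive_trmx//; last exact: dJ.
  rewrite derive_mulmx// (derive_cst eta) (derive_cst Z).
  by rewrite !mulmx0 !addr0.
have -> : curvature g u X Y Z = nabla g X (fun w => christoffel g w Y Z) u -
    nabla g Y (fun w => christoffel g w X Z) u.
  by congr (nabla g X _ u - nabla g Y _ u); exact: nablaE.
exact: (curvature_matrix_identity (key X Y) (key Y X) (derive_sym oA X Y sJ Au)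
  (gram_christoffel X (christoffel g u Y Z) Au)
  (gram_christoffel Y (christoffel g u X Z) Au)).
Qed.

(** The curvature is that of the flat ambient space, zero, corrected by the second
    fundamental form. *)
Lemma gauss_equation u X Y Z W : A u ->
  form (g u) (curvature g u X Y Z) W =
  ip nu (normal_hessian u X W) (normal_hessian u Y Z) -
  ip nu (normal_hessian u Y W) (normal_hessian u X Z).
Proof.
move=> Au; rewrite form_sym; last by rewrite (gE Au) gram_sym.
have e := curvatureE X Y Z Au.
have nX := normal_hessian_normal X Z Au; have nY := normal_hessian_normal Y Z Au.
rewrite /form -mulmxA e mulmxBr mxE [X in _ + X]mxE.
(* The tangent part of a second derivative is orthogonal to a normal vector. *)
have split_hess X' v : (J u)^T *m eta *m v = 0 ->
    ip nu (normal_hessian u X' W) v = (W^T *m ((DJ_ X' u)^T *m eta *m v)) 0 0.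
  move=> nv; rewrite /ip /normal_hessian formDl formNl.
  rewrite -(@form_adj _ _ _ eta 1%:M (J u) (christoffel g u X' W) v 0) ?form0r; last first.
    by rewrite mulmx0.
  by rewrite subr0 /form trmx_mul !mulmxA.
by rewrite (split_hess X _ nY) (split_hess Y _ nX).
Qed.

End GaussEquation.

(** * Immersions in a space form *)

Lemma col_eq0 (R : realType) n (v : 'cV[R]_n) :
  (forall X : 'cV[R]_n, (X^T *m v) 0 0 = 0) -> v = 0.
Proof.
move=> e; apply/colP => i; have := e (delta_mx i 0).
by rewrite trmx_delta -rowE !mxE.
Qed.

Lemma mx11_eq (R : realType) (M M' : 'M[R]_1) : M 0 0 = M' 0 0 -> M = M'.
Proof. by move=> e; apply/matrixP => i j; rewrite !ord1. Qed.

Section SpaceFormImmersion.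
Variables (R : realType) (N nu n : nat) (ct : R) (A : set 'cV[R]_n).
Variables (g : 'cV[R]_n -> 'M[R]_n) (F : 'cV[R]_n -> 'cV[R]_N).
Hypothesis oA : open A.
Hypothesis sF : smooth_on A F.
Hypothesis gE : forall u, A u -> g u = gram nu F u.
Hypothesis gU : forall u, A u -> g u \in unitmx.
Hypothesis Fct : forall u, A u -> space_form nu ct (F u).

Local Notation J := (jac F).
Local Notation eta := (eta R N nu).
Local Notation "'DJ_' X u" := ('D_X (jac F) u) (at level 10, X at level 8, u at level 8).

Let sJ : smooth_on A J. Proof. exact: smooth_jac. Qed.
Let dJ u : A u -> differentiable J u. Proof. by move=> Au; apply: smooth_diff sJ Au. Qed.
Let dF u : A u -> differentiable F u. Proof. by move=> Au; apply: smooth_diff sF Au. Qed.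
Let dc (a b : nat) (c : 'M[R]_(a, b)) u : differentiable (fun _ : 'cV[R]_n => c) u.
Proof. exact: differentiable_cst. Qed.

(** The derivative of the constant <F, F>. The factor ct lets the same statement
    cover ct = 0, where F is not constrained. *)
Lemma position_normal u : A u -> ct *: ((J u)^T *m eta *m F u) = 0.
Proof.
move=> Au; have [->|ct0] := eqVneq ct 0; first by rewrite scale0r.
rewrite (_ : _ *m F u = 0) ?scaler0//; apply: col_eq0 => X.
have e : 'D_X (fun w => (F w)^T *m eta *m F w) u = 0.
  rewrite (derive_eq_on oA (h := fun=> (ct^-1)%:M)) ?derive_cst// => w Aw.
  by apply: mx11_eq; rewrite [RHS]mxE eqxx mulr1n; apply: (Fct Aw).
move: e; have dt := differentiable_trmx (dF Au).
rewrite derive_mulmx//; [|exact: differentiable_mulmx|exact: dF].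
rewrite derive_mulmx// derive_trmx//; last exact: dF.
rewrite (derive_cst eta) mulmx0 addr0 -(jac_mulE X (dF Au)).
have -> : (F u)^T *m eta *m (J u *m X) = ((J u *m X)^T *m eta *m F u)^T.
  by rewrite !trmx_mul eta_sym !trmxK !mulmxA.
rewrite trmx_mul -!mulmxA; move: (X^T *m _) => q.
move/(congr1 (fun Q : 'M[R]_1 => Q 0 0)); rewrite !mxE => /eqP.
by rewrite -mulr2n mulrn_eq0 /= => /eqP.
Qed.

Lemma ip_position_tangent u Z : A u -> ct * ip nu (J u *m Z) (F u) = 0.
Proof.
move=> Au.
have -> : ct * ip nu (J u *m Z) (F u) = (Z^T *m (ct *: ((J u)^T *m eta *m F u))) 0 0.
  by rewrite -scalemxAr mxE /ip /form trmx_mul !mulmxA.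
by rewrite position_normal// mulmx0 mxE.
Qed.

(** Differentiate position_normal: this is the umbilicity of the space form in its
    ambient space. *)
Lemma position_hessian u X : A u ->
  ct *: ((DJ_ X u)^T *m eta *m F u) = - (ct *: (g u *m X)).
Proof.
move=> Au.
have e : 'D_X (fun w => ct *: ((J w)^T *m eta *m F w)) u = 0.
  by rewrite (derive_eq_on oA (h := fun=> 0)) ?derive_cst// => w; exact: position_normal.
move: e; have dt := differentiable_trmx (dJ Au).
rewrite derive_scale; last first.
  by apply: differentiable_mulmx; [exact: differentiable_mulmx|exact: dF].
rewrite derive_mulmx//; [|exact: differentiable_mulmx|exact: dF].
rewrite derive_mulmx// derive_trmx//; last exact: dJ.
rewrite (derive_cst eta) mulmx0 addr0 -(jac_mulE X (dF Au)) scalerDr.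
by rewrite mulmxA gE// => /eqP; rewrite addr_eq0 => /eqP.
Qed.

Lemma tangent_christoffel u X Y : A u ->
  christoffel g u X Y = tangent_part nu g F u (DJ_ X u *m Y).
Proof.
move=> Au; rewrite /tangent_part -!mulmxA [X in _ *m X]mulmxA.
by rewrite -(gram_christoffel oA sF gE gU X Y Au) mulKmx// gU.
Qed.

Lemma ip_hessian_position u X Y : A u ->
  ct * ip nu (DJ_ X u *m Y) (F u) = - (ct * form (g u) X Y).
Proof.
move=> Au.
have -> : ct * ip nu (DJ_ X u *m Y) (F u) =
    (Y^T *m (ct *: ((DJ_ X u)^T *m eta *m F u))) 0 0.
  by rewrite -scalemxAr mxE /ip /form trmx_mul !mulmxA.
rewrite position_hessian// mulmxN -scalemxAr mulmxA mxE [in LHS]mxE -/(form (g u) Y X).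
by rewrite form_sym// (gE Au) gram_sym.
Qed.

(** If ct <> 0, the normal bundle of f lacks the direction of F in the flat one,
    and position_hessian gives the component in that direction. *)
Lemma second_formE u X Y : A u ->
  second_form nu ct g F u X Y =
  normal_hessian g F u X Y + (ct * form (g u) X Y) *: F u.
Proof.
move=> Au; rewrite /second_form (derive_jac oA)// /normal_part.
by rewrite -tangent_christoffel// ip_hessian_position// scaleNr opprK.
Qed.

(** On vectors normal to f, the tangent part and the component along F of a second
    derivative do not contribute, so that the shape operator can be read from the
    plain second derivatives of F. *)
Lemma shapeE u xi X : A u -> (J u)^T *m eta *m xi = 0 -> ct * ip nu (F u) xi = 0 ->
  g u *m shape nu ct g F u xi X = (DJ_ X u)^T *m eta *m xi.
Proof.
move=> Au Jxi Fxi; rewrite /shape mulKVmx ?gU//.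
apply/colP => l; rewrite mxE second_formE//.
rewrite /ip formDl formZl [_ * form eta (F u) xi](_ : _ = 0); last first.
  by rewrite mulrAC -/(ip nu (F u) xi) Fxi mul0r.
rewrite addr0 /normal_hessian formDl formNl.
have -> : form eta (J u *m christoffel g u X (delta_mx l 0)) xi = 0.
  by rewrite /form trmx_mul -!mulmxA [X in _ *m X]mulmxA Jxi mulmx0 mxE.
rewrite subr0 /form trmx_mul trmx_delta -!mulmxA -rowE mxE.
by rewrite mulmxA.
Qed.

End SpaceFormImmersion.

(** * The Ribaucour transform in coordinates *)

Lemma mx_eq_mul (R : realType) a b (M M' : 'M[R]_(a, b)) :
  (forall v : 'cV[R]_b, M *m v = M' *m v) -> M = M'.
Proof.
by move=> e; apply/matrixP => i j; have /colP/(_ i) := e (delta_mx j 0);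
  rewrite -!colE !mxE.
Qed.

Lemma dotE (R : realType) m (x y : 'cV[R]_m) : x^T *m y = (dot x y)%:M.
Proof. by rewrite /dot /form mulmx1; apply: mx11_eq; rewrite [RHS]mxE eqxx mulr1n. Qed.

(** The computation of derive_calG_mul on matrices: j, w, db, k and d stand for
    jac F, omega_t, the derivative of beta, <d phi, v> and <phi, v>, while C and S
    stand for the Christoffel and the shape term of Phi. The hypothesis is the
    condition that relates alpha and beta. *)
Lemma calG_column_identity (R : realType) (N n m : nat) (ct k d : R)
    (j DJ : 'M[R]_(N, n)) (w dw : 'M[R]_(n, m)) (db : 'M[R]_(N, m))
    (v : 'cV[R]_m) (F : 'cV[R]_N) (X C S : 'cV[R]_n) :
  DJ *m (w *m v) - j *m C + (ct * k) *: F + (db *m v + j *m S) = 0 ->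
  DJ *m w *m v + j *m dw *m v + db *m v +
    ct *: (j *m X *m d%:M + F *m k%:M) =
  j *m (dw *m v + C - S + (ct * d) *: X).
Proof.
move=> e; rewrite !mulmxDr mulmxN !mul_mx_scalar -scalemxAr scalerDr !scalerA.
rewrite -[RHS]addr0 -e !mulmxA.
by apply/matrixP => a b; rewrite !mxE; ring.
Qed.

(** The map 1 - K O^-1 K^t is an isometry for the form E as soon as the
    symmetric part of O is half of K^t K. *)
Lemma ribaucour_isometry_identity (R : realType) (N m : nat) (E : 'M[R]_N)
    (K : 'M[R]_(N, m)) (O : 'M[R]_m) : E^T = E -> O \in unitmx ->
  O + O^T = K^T *m E *m K ->
  (1%:M - K *m invmx O *m K^T *m E)^T *m E *m (1%:M - K *m invmx O *m K^T *m E) = E.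
Proof.
move=> sE uO e.
have e2 : (invmx O)^T *m (K^T *m E *m K) *m invmx O = invmx O + (invmx O)^T.
  rewrite -e mulmxDr mulmxDl -mulmxA mulmxV// mulmx1.
  by rewrite -trmx_mul mulmxV// trmx1 mul1mx addrC.
rewrite [(_ - _)^T]linearB/= trmx1 !trmx_mul trmxK sE mulmxBl mul1mx mulmxBr mulmx1 mulmxBl.
have -> : E *m (K *m ((invmx O)^T *m K^T)) *m E *m (K *m invmx O *m K^T *m E) =
   E *m K *m ((invmx O)^T *m (K^T *m E *m K) *m invmx O) *m K^T *m E.
  by rewrite !mulmxA.
rewrite e2 mulmxDr !mulmxDl !mulmxA.
by apply/matrixP => a b; rewrite !mxE; ring.
Qed.

(** The derivative of F - K W phi, where K has derivative j Ph, W has derivative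
    - W K^t (j Ph) W, and phi has derivative K^t j. *)
Lemma derive_transform_identity (R : realType) (N n m : nat) (E : 'M[R]_N)
    (j : 'M[R]_(N, n)) (Ph : 'M[R]_(n, m)) (K : 'M[R]_(N, m)) (W : 'M[R]_m)
    (f : 'cV[R]_m) (Y : 'cV[R]_n) :
  j *m Y - ((j *m Ph *m W + K *m - (W *m (K^T *m E *m (j *m Ph)) *m W)) *m f +
    K *m W *m (K^T *m E *m j *m Y)) =
  (1%:M - K *m W *m K^T *m E) *m j *m (Y - Ph *m W *m f).
Proof.
rewrite !mulmxBr !mulmxBl !mul1mx !mulmxDl !mulmxN !mulNmx !mulmxA.
by apply/matrixP => a b; rewrite !mxE; ring.
Qed.

(** The derivative of P = 1 - K W K^t, restricted to the image of j. One term of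
    the product rule acquires a factor P because K W = - P K W^t. *)
Lemma derive_projection_identity (R : realType) (N n m : nat) (E : 'M[R]_N)
    (j : 'M[R]_(N, n)) (Ph : 'M[R]_(n, m)) (K : 'M[R]_(N, m)) (O : 'M[R]_m) :
  O \in unitmx -> O + O^T = K^T *m E *m K ->
  let W := invmx O in
  - (((j *m Ph *m W + K *m - (W *m (K^T *m E *m (j *m Ph)) *m W)) *m K^T +
     K *m W *m (j *m Ph)^T) *m E) *m j =
  (1%:M - K *m W *m K^T *m E) *m
    (K *m W^T *m Ph^T *m (j^T *m E *m j) - j *m Ph *m W *m (K^T *m E *m j)).
Proof.
move=> uO e W.
(* Both sides of the defining relation of O meet here: K^t K = O + O^t. *)
have PK : (1%:M - K *m W *m K^T *m E) *m K *m W^T = - (K *m W).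
  rewrite mulmxBl mul1mx -!mulmxA [X in K - _ *m (_ *m X)]mulmxA -e mulmxBl.
  rewrite -!mulmxA [X in _ - _ *m X]mulmxA mulmxDr /W mulVmx//.
  rewrite mulmxDl mul1mx mulmxDr opprD addrA subrr sub0r -!mulmxA -trmx_mul mulVmx//.
  by rewrite trmx1 mulmx1.
rewrite mulmxBr !mulmxA PK trmx_mul.
rewrite !mulmxBl !mul1mx !mulmxDl !mulmxN !mulNmx !mulmxDl !mulNmx !mulmxA.
by apply/matrixP => a b; rewrite !mxE; ring.
Qed.

(** Splits the derivative of P j D into P applied to a tangent vector and P applied
    to a normal one: w and B are the tangent and the normal part of K, and C is the
    Christoffel part of the derivative DJ of j. *)
Lemma hessian_transform_identity (R : realType) (N n m : nat) (P : 'M[R]_N)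
    (j DJ : 'M[R]_(N, n)) (Ph w : 'M[R]_(n, m)) (K B : 'M[R]_(N, m)) (V : 'M[R]_m)
    (gu dD : 'M[R]_n) (jf : 'M[R]_(m, n)) (D : 'M[R]_n) (C Y : 'cV[R]_n) :
  K = j *m w + B ->
  ((P *m (K *m V^T *m Ph^T *m gu - j *m Ph *m V *m jf) + P *m DJ) *m D
    + P *m j *m dD) *m Y =
  P *m (j *m (C + w *m V^T *m Ph^T *m (gu *m (D *m Y)) - Ph *m V *m jf *m (D *m Y)
    + dD *m Y) +
    (DJ *m (D *m Y) - j *m C + B *m V^T *m Ph^T *m (gu *m (D *m Y)))).
Proof.
move=> ->; rewrite !(mulmxDl, mulmxDr, mulmxN, mulNmx, mulmxA).
by apply/matrixP => a b; rewrite !mxE; ring.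
Qed.

(** The second condition on L, evaluated on vectors b1, b2 that O^t sends to
    P1^t Z1 and P2^t Z2. *)
Lemma L_quadratic_identity (R : realType) (n m : nat) (k : R) (O L Q : 'M[R]_m)
    (f b1 b2 : 'cV[R]_m) (gu : 'M[R]_n) (P1 P2 : 'M[R]_(n, m)) (Z1 Z2 : 'cV[R]_n) :
  gu^T = gu -> O *m L + L^T *m O^T = Q - k *: (f *m f^T) ->
  O^T *m b1 = P1^T *m (gu *m Z1) -> O^T *m b2 = P2^T *m (gu *m Z2) ->
  form Q b1 b2 = form gu Z1 (P1 *m (L *m b2)) + form gu Z2 (P2 *m (L *m b1)) +
    k * dot f b1 * dot f b2.
Proof.
move=> gS e e1 e2.
have formDm (B C : 'M[R]_m) x y : form (B + C) x y = form B x y + form C x y.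
  by rewrite /form mulmxDr mulmxDl mxE.
rewrite -[Q](subrK (k *: (f *m f^T))) -e !formDm; congr (_ + _ + _).
- rewrite /form !mulmxA -[_^T *m O]trmxK trmx_mul trmxK e1.
  by rewrite !trmx_mul trmxK gS ?mulmxA.
- rewrite [RHS]form_sym// /form mulmxA -trmx_mul -mulmxA e2.
  by rewrite !trmx_mul ?mulmxA.
- rewrite /form -scalemxAr -scalemxAl mxE -mulrA; congr (_ * _).
  have -> : b1^T *m (f *m f^T) *m b2 = (b1^T *m f) *m (f^T *m b2) by rewrite !mulmxA.
  rewrite !dotE -scalar_mxM mxE eqxx mulr1n; congr (_ * _).
  by rewrite /dot form_sym// trmx1.
Qed.

Section Ribaucour.
Variables (R : realType) (N nu n m : nat) (ct : R) (A : set 'cV[R]_n).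
Variables (g : 'cV[R]_n -> 'M[R]_n) (F : 'cV[R]_n -> 'cV[R]_N).
Variables (phi : 'cV[R]_n -> 'cV[R]_m) (beta : 'cV[R]_n -> 'M[R]_(N, m)).
Variable Omega : 'cV[R]_n -> 'M[R]_m.
Hypothesis oA : open A.
Hypothesis sF : smooth_on A F.
Hypothesis gE : forall u, A u -> g u = gram nu F u.
Hypothesis gU : forall u, A u -> g u \in unitmx.
Hypothesis Fct : forall u, A u -> space_form nu ct (F u).
Hypothesis sphi : smooth_on A phi.
Hypothesis sbeta : smooth_on A beta.
Hypothesis sOmega : smooth_on A Omega.
Hypothesis rib : forall u, A u -> ribaucour_at nu ct g F phi beta Omega u.

Local Notation J := (jac F).
Local Notation eta := (eta R N nu).
Local Notation "'DJ_' X u" := ('D_X (jac F) u) (at level 10, X at level 8, u at level 8).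
Local Notation G := (calG ct g F phi beta).
Local Notation ot := (omega_t g phi).

Let gS u : A u -> (g u)^T = g u. Proof. by move=> Au; rewrite gE// gram_sym. Qed.
Let sg : smooth_on A g. Proof. exact: gram_smooth oA sF gE. Qed.
Let sJ : smooth_on A J. Proof. exact: smooth_jac. Qed.
Let dJ u : A u -> differentiable J u. Proof. by move=> Au; apply: smooth_diff sJ Au. Qed.
Let dF u : A u -> differentiable F u. Proof. by move=> Au; apply: smooth_diff sF Au. Qed.
Let dphi u : A u -> differentiable phi u. Proof. by move=> Au; apply: smooth_diff sphi Au. Qed.
Let dbeta u : A u -> differentiable beta u. Proof. by move=> Au; apply: smooth_diff sbeta Au. Qed.
Let dc (a b : nat) (c : 'M[R]_(a, b)) u : differentiable (fun _ : 'cV[R]_n => c) u.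
Proof. exact: differentiable_cst. Qed.

Lemma omega_t_smooth : smooth_on A ot.
Proof.
apply: (smooth_mul oA); first exact: (smooth_inv oA gU sg).
by apply: (smooth_tr oA); apply: (smooth_jac oA).
Qed.

Lemma calG_smooth : smooth_on A G.
Proof.
apply: (smooth_add oA); first apply: (smooth_add oA) => //.
  by apply: (smooth_mul oA) => //; exact: omega_t_smooth.
apply: (smooth_scale oA); apply: (smooth_mul oA) => //.
exact: (smooth_tr oA).
Qed.

Let dot_ u : A u -> differentiable ot u.
Proof. by move=> Au; apply: smooth_diff omega_t_smooth Au. Qed.
Let dG u : A u -> differentiable G u.
Proof. by move=> Au; apply: smooth_diff calG_smooth Au. Qed.

Lemma beta_tangent u : A u -> (J u)^T *m eta *m beta u = 0.
Proof.
move=> Au; have [nb _] := rib Au; apply: mx_eq_mul => v; rewrite mul0mx.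
apply: col_eq0 => X; have [/(_ X) e _] := nb v.
by move: e; rewrite ip_sym /ip /form trmx_mul !mulmxA.
Qed.

Lemma beta_position u v : A u -> ct * ip nu (beta u *m v) (F u) = 0.
Proof. by move=> Au; have [nb _] := rib Au; have [_] := nb v. Qed.

(** Differentiate <beta v, F> = 0 and use that beta v is normal. *)
Lemma derive_beta_position u X v : A u -> ct * ip nu ('D_X beta u *m v) (F u) = 0.
Proof.
move=> Au.
have e : 'D_X (fun w => ct *: ((beta w *m v)^T *m eta *m F w)) u = 0.
  rewrite (derive_eq_on oA (h := fun=> 0)) ?derive_cst// => w Aw.
  by apply: mx11_eq; rewrite !mxE; have := beta_position v Aw; rewrite /ip /form !mxE.
have db := dbeta Au; have dbv : differentiable (fun w => beta w *m v) u.
  by apply: differentiable_mulmx.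
have dt := differentiable_trmx dbv.
move: e; rewrite derive_scale; last first.
  by apply: differentiable_mulmx; [exact: differentiable_mulmx|exact: dF].
rewrite derive_mulmx//; [|exact: differentiable_mulmx|exact: dF].
rewrite derive_mulmx// derive_trmx// derive_mulmx// (derive_cst eta) (derive_cst v).
rewrite !mulmx0 !addr0 -(jac_mulE X (dF Au)) scalerDr.
have -> : (beta u *m v)^T *m eta *m (J u *m X) =
   ((X^T *m ((J u)^T *m eta *m beta u)) *m v)^T.
  by rewrite !trmx_mul eta_sym !trmxK !mulmxA.
rewrite beta_tangent// mulmx0 mul0mx trmx0 scaler0 addr0.
by move/(congr1 (fun Q : 'M[R]_1 => Q 0 0)); rewrite mxE [RHS]mxE.
Qed.

(** Weingarten's formula, obtained by differentiating J^t beta = 0. *)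
Lemma tangent_derive_beta u X v : A u ->
  tangent_part nu g F u ('D_X beta u *m v) = - shape nu ct g F u (beta u *m v) X.
Proof.
move=> Au.
have e : 'D_X (fun w => (J w)^T *m eta *m beta w) u = 0.
  rewrite (derive_eq_on oA (h := fun=> 0)) ?derive_cst// => w Aw.
  exact: beta_tangent.
have dt := differentiable_trmx (dJ Au).
move: e; rewrite derive_mulmx//; [|exact: differentiable_mulmx|exact: dbeta].
rewrite derive_mulmx// derive_trmx//; last exact: dJ.
rewrite (derive_cst eta) mulmx0 addr0 addrC => /eqP; rewrite addr_eq0 => /eqP e.
have sh : g u *m shape nu ct g F u (beta u *m v) X = (DJ_ X u)^T *m eta *m (beta u *m v).
  apply: (shapeE oA sF gE gU Fct) => //; first by rewrite mulmxA beta_tangent// mul0mx.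
  by rewrite ip_sym beta_position.
rewrite -[RHS](mulKmx (gU Au)) mulmxN sh mulmxA -[in RHS]mulNmx -e.
by rewrite /tangent_part !mulmxA.
Qed.

Lemma omega_t_form u X v : A u ->
  form (g u) X (ot u *m v) = (('D_X phi u)^T *m v) 0 0.
Proof.
move=> Au; rewrite -(jac_mulE X (dphi Au)) /form /omega_t trmx_mul.
by rewrite !mulmxA mulmxK ?gU.
Qed.

Lemma derive_calGE u X : A u ->
  'D_X G u = DJ_ X u *m ot u + J u *m 'D_X ot u + 'D_X beta u +
   ct *: (J u *m X *m (phi u)^T + F u *m ('D_X phi u)^T).
Proof.
move=> Au; have dt := differentiable_trmx (dphi Au).
have d1 : differentiable (fun w => J w *m ot w) u.
  by apply: differentiable_mulmx; [exact: dJ|exact: dot_].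
have d2 : differentiable (fun w => F w *m (phi w)^T) u.
  by apply: differentiable_mulmx => //; exact: dF.
have db := dbeta Au.
rewrite derive_add; [|exact: differentiableD|exact: (@differentiableZ _ _ _ _ ct)].
rewrite derive_add// derive_scale// derive_mulmx; [|exact: dJ|exact: dot_].
rewrite derive_mulmx//; last exact: dF.
by rewrite derive_trmx -?(jac_mulE X (dF Au))//; exact: dphi.
Qed.

(** The tangential components of the derivative add up to Phi. The components
    normal to f vanish by the relation between alpha and beta, and those along F
    cancel. *)
Lemma derive_calG_mul u X v : A u ->
  'D_X G u *m v = J u *m Phi nu ct g F phi beta u v X.
Proof.
move=> Au; have [_ [/(_ X v) cod _]] := rib Au.
rewrite (second_formE oA sF gE gU Fct)// in cod.
rewrite omega_t_form// in cod.
have nn : normal_nabla nu ct g F X (fun w => beta w *m v) u =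
    'D_X beta u *m v + J u *m shape nu ct g F u (beta u *m v) X.
  rewrite /normal_nabla derive_mulmx//; last exact: dbeta.
  rewrite (derive_cst v) mulmx0 addr0 /normal_part derive_beta_position//.
  by rewrite scale0r subr0 tangent_derive_beta// mulmxN opprK.
have dn : nabla g X (fun w => ot w *m v) u = 'D_X ot u *m v + christoffel g u X (ot u *m v).
  by rewrite /nabla derive_mulmx//; [rewrite (derive_cst v) mulmx0 addr0|exact: dot_].
rewrite /Phi dn derive_calGE//.
rewrite nn /normal_hessian in cod.
rewrite !mulmxDl -scalemxAl mulmxDl -(mulmxA (J u *m X)) -(mulmxA (F u)) dotE.
have -> : ('D_X phi u)^T *m v = ((('D_X phi u)^T *m v) 0 0)%:M.
  by apply: mx11_eq; rewrite [RHS]mxE eqxx mulr1n.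
exact: calG_column_identity cod.
Qed.


Let gJ u : A u -> g u = (J u)^T *m eta *m J u. Proof. exact: gE. Qed.

(** Phi(X), as a matrix from V to the tangent space, is the tangent part of the
    derivative of calG. Matrices are needed because the transpose Phi(X)^t enters
    the second fundamental form of the transform. *)
Definition Phi_mx u X : 'M[R]_(n, m) :=
  invmx (g u) *m ((J u)^T *m eta *m 'D_X G u).

Lemma Phi_mx_mul u X v : A u -> Phi_mx u X *m v = Phi nu ct g F phi beta u v X.
Proof.
move=> Au.
have -> : Phi_mx u X *m v = invmx (g u) *m ((J u)^T *m eta *m ('D_X G u *m v)).
  by rewrite /Phi_mx !mulmxA.
by rewrite derive_calG_mul// [_ *m (J u *m _)]mulmxA -gJ// mulKmx ?gU.
Qed.

Lemma derive_calG u X : A u -> 'D_X G u = J u *m Phi_mx u X.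
Proof.
by move=> Au; apply: mx_eq_mul => v; rewrite derive_calG_mul// -mulmxA Phi_mx_mul.
Qed.

Lemma calG_jac u : A u -> (G u)^T *m eta *m J u = jac phi u.
Proof.
move=> Au; rewrite /calG !linearD/= linearZ/= !mulmxDl !trmx_mul !trmxK.
rewrite -!scalemxAl.
have -> : (beta u)^T *m eta *m J u = ((J u)^T *m eta *m beta u)^T.
  by rewrite !trmx_mul eta_sym trmxK mulmxA.
have -> : ct *: (phi u *m (F u)^T *m eta *m J u) =
    phi u *m (ct *: ((J u)^T *m eta *m F u))^T.
  by rewrite linearZ/= !trmx_mul eta_sym trmxK -scalemxAr !mulmxA.
rewrite (position_normal oA sF Fct Au) beta_tangent// !trmx0 mulmx0.
by rewrite !addr0 trmx_inv gS// -!mulmxA [_ *m (eta *m _)]mulmxA -gJ// mulVmx ?mulmx1 ?gU.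
Qed.

Local Notation W := (fun u => invmx (Omega u)).

Let uO u : A u -> Omega u \in unitmx.
Proof. by move=> Au; have [_ [_ [_ []]]] := rib Au. Qed.
Let dO u : A u -> differentiable Omega u.
Proof. by move=> Au; apply: smooth_diff sOmega Au. Qed.
Let OO u : A u -> Omega u + (Omega u)^T = (G u)^T *m eta *m G u.
Proof. by move=> Au; have [_ [_ [_ [_ []]]]] := rib Au. Qed.

Lemma derive_W u X : A u ->
  'D_X W u = - (W u *m ((G u)^T *m eta *m (J u *m Phi_mx u X)) *m W u).
Proof.
move=> Au; rewrite derive_invmx//; [|exact: dO|exact: uO].
by have [_ [_ [_ [_ [-> _]]]]] := rib Au; rewrite derive_calG.
Qed.

(** The ambient isometry that carries the tangent and normal spaces of f to those
    of the transform. *)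
Definition ribP u : 'M[R]_N := 1%:M - G u *m W u *m (G u)^T *m eta.

Lemma ribaucour_P_isometry u : A u -> (ribP u)^T *m eta *m ribP u = eta.
Proof.
by move=> Au; apply: ribaucour_isometry_identity; [exact: eta_sym|exact: uO|exact: OO].
Qed.

Variable Ft : 'cV[R]_n -> 'cV[R]_N.
Hypothesis FtE : forall u, A u -> Ft u = ribaucour_transform ct g F phi beta Omega u.

Let sW : smooth_on A W. Proof. exact: (smooth_inv oA uO sOmega). Qed.
Let dW u : A u -> differentiable W u.
Proof. by move=> Au; apply: smooth_diff sW Au. Qed.

Lemma transform_smooth : smooth_on A Ft.
Proof.
apply: (smooth_eq oA (f := ribaucour_transform ct g F phi beta Omega)).
  by move=> w Aw; rewrite FtE.
apply: (smooth_sub oA) => //; apply: (smooth_mul oA) => //.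
by apply: (smooth_mul oA) => //; exact: calG_smooth.
Qed.

(** The product rule for F - calG Omega^-1 phi, with d Omega = calG^t d calG and
    d phi = calG^t F_*. *)
Lemma derive_transform u Y : A u ->
  'D_Y Ft u = ribP u *m J u *m (Y - Phi_mx u Y *m W u *m phi u).
Proof.
move=> Au; rewrite (derive_eq_on oA (h := fun w => F w + - (G w *m W w *m phi w)))//.
have d1 : differentiable (fun w => G w *m W w) u.
  by apply: differentiable_mulmx; [exact: dG|exact: dW].
have d2 : differentiable (fun w => G w *m W w *m phi w) u.
  by apply: differentiable_mulmx => //; exact: dphi.
rewrite derive_add; [|exact: dF|exact: (@differentiableN _ _ _ _ _ d2)].
rewrite derive_opp// derive_mulmx//; last exact: dphi.
rewrite derive_mulmx; [|exact: dG|exact: dW].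
rewrite derive_calG// derive_W// -(jac_mulE Y (dF Au)) -(jac_mulE Y (dphi Au)).
rewrite -calG_jac//; exact: derive_transform_identity.
Qed.

(** The tangent endomorphism D with jac Ft = P (jac F) D, solved for D with the help
    of the isometry P, so that its smoothness is immediate. *)
Definition ribD u : 'M[R]_n := invmx (g u) *m ((ribP u *m J u)^T *m eta *m jac Ft u).

Let PJ_isometry u : A u -> (ribP u *m J u)^T *m eta *m (ribP u *m J u) = g u.
Proof.
move=> Au; rewrite gJ// -[in RHS](ribaucour_P_isometry Au) trmx_mul.
by rewrite !mulmxA.
Qed.

(** The tensor D = 1 - Phi_(Omega^-1 phi), by which the induced metric changes. *)
Lemma ribaucour_D_mul u Y : A u -> ribD u *m Y = Y - Phi_mx u Y *m W u *m phi u.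
Proof.
move=> Au.
have -> : ribD u *m Y = invmx (g u) *m ((ribP u *m J u)^T *m eta *m (jac Ft u *m Y)).
  by rewrite /ribD !mulmxA.
rewrite (jac_mulE Y (smooth_diff transform_smooth Au)) derive_transform//.
by rewrite [_ *m (ribP u *m J u *m _)]mulmxA PJ_isometry// mulKmx ?gU.
Qed.

Lemma jac_transform u : A u -> jac Ft u = ribP u *m J u *m ribD u.
Proof.
move=> Au; apply: mx_eq_mul => Y; rewrite (jac_mulE Y (smooth_diff transform_smooth Au)).
by rewrite -[RHS]mulmxA ribaucour_D_mul// derive_transform.
Qed.

(** P is an isometry. *)
Lemma gram_transform u : A u -> gram nu Ft u = (ribD u)^T *m g u *m ribD u.
Proof.
by move=> Au; rewrite /gram jac_transform// -[in RHS]PJ_isometry// [in LHS]trmx_mul !mulmxA.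
Qed.


(** * The second derivatives of the transform *)

Lemma ribaucour_P_smooth : smooth_on A ribP.
Proof.
apply: (smooth_sub oA); first exact: (smooth_cst oA).
apply: (smooth_mul oA); last exact: (smooth_cst oA).
apply: (smooth_mul oA); last by apply: (smooth_tr oA); exact: calG_smooth.
by apply: (smooth_mul oA) => //; exact: calG_smooth.
Qed.

Lemma ribaucour_D_smooth : smooth_on A ribD.
Proof.
apply: (smooth_mul oA); first exact: (smooth_inv oA gU sg).
apply: (smooth_mul oA); last exact: (smooth_jac oA transform_smooth).
apply: (smooth_mul oA); last exact: (smooth_cst oA).
by apply: (smooth_tr oA); apply: (smooth_mul oA) => //; exact: ribaucour_P_smooth.
Qed.

Lemma derive_ribaucour_P u X : A u -> 'D_X ribP u =
  - (((J u *m Phi_mx u X *m W u +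
      G u *m - (W u *m ((G u)^T *m eta *m (J u *m Phi_mx u X)) *m W u)) *m (G u)^T +
     G u *m W u *m (J u *m Phi_mx u X)^T) *m eta).
Proof.
move=> Au; have dGu := dG Au; have dt := differentiable_trmx dGu.
have dWu := dW Au.
have d1 : differentiable (fun w => G w *m W w) u by exact: differentiable_mulmx.
have d2 : differentiable (fun w => G w *m W w *m (G w)^T) u by exact: differentiable_mulmx.
have d3 : differentiable (fun w => G w *m W w *m (G w)^T *m eta) u by exact: differentiable_mulmx.
have -> : 'D_X ribP u = 'D_X (fun w => 1%:M + - (G w *m W w *m (G w)^T *m eta)) u by [].
rewrite derive_add//; last exact: (@differentiableN _ _ _ _ _ d3).
rewrite (derive_cst (1%:M : 'M[R]_N)) add0r derive_opp// derive_mulmx//.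
rewrite (derive_cst eta) mulmx0 addr0 derive_mulmx// derive_trmx// derive_mulmx//.
by rewrite derive_calG// derive_W.
Qed.

Lemma derive_jac_transform u X : A u -> 'D_X (jac Ft) u =
  (ribP u *m (G u *m (W u)^T *m (Phi_mx u X)^T *m g u
    - J u *m Phi_mx u X *m W u *m jac phi u) + ribP u *m DJ_ X u) *m ribD u
  + ribP u *m J u *m 'D_X ribD u.
Proof.
move=> Au; rewrite (derive_eq_on oA (h := fun w => ribP w *m J w *m ribD w))//; last first.
  by move=> w Aw; rewrite jac_transform.
have dP : differentiable ribP u by apply: smooth_diff ribaucour_P_smooth Au.
have dD : differentiable ribD u by apply: smooth_diff ribaucour_D_smooth Au.
have dJu := dJ Au.
rewrite derive_mulmx//; last exact: differentiable_mulmx.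
rewrite derive_mulmx// derive_ribaucour_P// gJ// -calG_jac//.
by rewrite (derive_projection_identity _ _ (uO Au) (OO Au)).
Qed.

(** The vectors whose images under the isometry P are the values of the flat second
    fundamental form of the transform, evaluated at (X, D^-1 Z). *)
Definition pre_second_form (u X Z : 'cV[R]_n) : 'cV[R]_N :=
  normal_hessian g F u X Z +
  (beta u + ct *: (F u *m (phi u)^T)) *m (W u)^T *m (Phi_mx u X)^T *m (g u *m Z).

Lemma pre_second_form_normal u X Z : A u -> (J u)^T *m eta *m pre_second_form u X Z = 0.
Proof.
move=> Au; rewrite /pre_second_form mulmxDr (normal_hessian_normal oA sF gE gU)// add0r !mulmxA.
rewrite mulmxDr beta_tangent// add0r -scalemxAr mulmxA scalemxAl.
by rewrite (position_normal oA sF Fct Au) !mul0mx.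
Qed.

(** The isometry P splits off because the derivative of P along the tangent space
    of f is again P times a map. *)
Lemma hessian_transform u X Y : A u -> exists s : 'cV[R]_n,
  'D_X (jac Ft) u *m Y = ribP u *m (J u *m s + pre_second_form u X (ribD u *m Y)).
Proof.
move=> Au; eexists; rewrite derive_jac_transform//.
by apply: (@hessian_transform_identity _ _ _ _ _ (J u) _ _ (ot u)); rewrite /calG addrA.
Qed.

(** The transform is an immersion with nondegenerate metric exactly here, which is
    where the Gauss equation applies to it. *)
Definition transform_regular : set 'cV[R]_n := [set u | A u /\ gram nu Ft u \in unitmx].

Lemma open_transform_regular : open transform_regular.
Proof.
rewrite openE => u [Au gu]; apply: filterI; first exact: near_open.
apply: near_unitmx gu; apply: smooth_diff Au.
apply: (smooth_mul oA); last exact: (smooth_jac oA transform_smooth).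
apply: (smooth_mul oA); last exact: (smooth_cst oA).
by apply: (smooth_tr oA); exact: (smooth_jac oA transform_smooth).
Qed.

Let regA : transform_regular `<=` A. Proof. by move=> u []. Qed.
Let sFt : smooth_on transform_regular Ft. Proof. exact: smooth_subset regA transform_smooth. Qed.
Let gtU u : transform_regular u -> gram nu Ft u \in unitmx. Proof. by case. Qed.

(** In hessian_transform the tangent part of the second derivative must be the
    Christoffel part, as D is invertible at regular points. *)
Lemma normal_hessian_transform u X Y : transform_regular u ->
  normal_hessian (gram nu Ft) Ft u X Y = ribP u *m pre_second_form u X (ribD u *m Y).
Proof.
move=> ru; have Au := regA ru.
have := gram_christoffel open_transform_regular sFt (fun _ _ => erefl) gtU X Y ru.
rewrite /normal_hessian; have [s ->] := hessian_transform X Y Au.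
have := pre_second_form_normal X (ribD u *m Y) Au; move: (pre_second_form _ _ _) => v nv.
move: (christoffel _ _ _ _) => C; rewrite gram_transform// jac_transform// => e.
have uD : (ribD u)^T *m g u \in unitmx.
  by have := gtU ru; rewrite gram_transform// unitmx_mul => /andP[].
(* Both tangent vectors have the same products with the image of jac Ft. *)
have {e} : (ribD u)^T *m g u *m (ribD u *m C) = (ribD u)^T *m g u *m s.
  rewrite mulmxA e trmx_mul -!mulmxA; congr (_ *m _).
  rewrite [X in X = _](_ : _ = (ribP u *m J u)^T *m eta *m ribP u *m (J u *m s + v)); last first.
    by rewrite !mulmxA.
  have -> : (ribP u *m J u)^T *m eta *m ribP u = (J u)^T *m eta.
    by rewrite -[in RHS](ribaucour_P_isometry Au) trmx_mul !mulmxA.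
  by rewrite mulmxDr nv addr0 mulmxA -gJ.
move/(congr1 (fun M => invmx ((ribD u)^T *m g u) *m M)); rewrite !mulKmx// => <-.
by rewrite mulmxDr !mulmxA addrC addrA addNr add0r.
Qed.

Lemma gauss_transform u X Y Z Z' : transform_regular u ->
  form (gram nu Ft u) (curvature (gram nu Ft) u X Y Z) Z' =
  ip nu (pre_second_form u X (ribD u *m Z')) (pre_second_form u Y (ribD u *m Z)) -
  ip nu (pre_second_form u Y (ribD u *m Z')) (pre_second_form u X (ribD u *m Z)).
Proof.
move=> ru; rewrite (gauss_equation open_transform_regular sFt (fun _ _ => erefl) gtU)//.
rewrite !normal_hessian_transform//.
have iP x y : ip nu (ribP u *m x) (ribP u *m y) = ip nu x y.
  by rewrite /ip -form_mul ribaucour_P_isometry//; exact: regA.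
congr (_ - _); exact: iP.
Qed.

(** * The effect of the conditions on L *)

Section LTransform.
Variables (c : R) (L : 'M[R]_m).
Hypothesis Lc : forall u, A u -> L_condition_at nu ct g F phi beta Omega c L u.

(** The difference from the scalar products of the second fundamental form of F is
    purely metric. Put b = Omega^-t Phi(X)^t Z. The first condition on L turns the
    mixed products <B(X, Z), beta b'> into terms containing L, the second one turns
    <beta b, beta b'> into the same terms with the opposite sign, and what remains
    involves b only through <phi, b> = <X - D X, Z>. *)
Lemma ip_pre_second_form u X Y Z V : A u ->
  ip nu (pre_second_form u X Z) (pre_second_form u Y V) =
  ip nu (normal_hessian g F u X Z) (normal_hessian g F u Y V) +
  c * (form (g u) (ribD u *m X) Z * form (g u) (ribD u *m Y) V
     - form (g u) X Z * form (g u) Y V).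
Proof.
move=> Au; have [L1 L2] := Lc Au.
pose b (X Z : 'cV[R]_n) : 'cV[R]_m := (W u)^T *m (Phi_mx u X)^T *m (g u *m Z).
have pre_second_formE X' Z' : pre_second_form u X' Z' = normal_hessian g F u X' Z' + beta u *m b X' Z' +
    (ct * dot (phi u) (b X' Z')) *: F u.
  have e : (beta u + ct *: (F u *m (phi u)^T)) *m b X' Z' =
      beta u *m b X' Z' + (ct * dot (phi u) (b X' Z')) *: F u.
    by rewrite mulmxDl -scalemxAl -mulmxA dotE mul_mx_scalar scalerA.
  by rewrite -addrA -e /pre_second_form /b !mulmxA.
have ObE X' Z' : (Omega u)^T *m b X' Z' = (Phi_mx u X')^T *m (g u *m Z').
  by rewrite /b !mulmxA -trmx_mul mulVmx ?uO// trmx1 mul1mx.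
(* The component of phi along b measures how far D is from the identity. *)
have n1 X' Z' : dot (phi u) (b X' Z') = form (g u) X' Z' - form (g u) (ribD u *m X') Z'.
  rewrite ribaucour_D_mul// formDl formNl opprB addrC subrK.
  by rewrite /b /dot /form !trmx_mul mulmx1 !mulmxA.
(* The first condition on L, paired with Z'. *)
have n2 X' Z' v : ip nu (normal_hessian g F u X' Z') (beta u *m v) =
    - form (g u) Z' (Phi_mx u X' *m (L *m v)) - (c - ct) * dot (phi u) v * form (g u) X' Z'.
  have := congr1 (form (g u) Z') (L1 v X'); rewrite -Phi_mx_mul//.
  rewrite !formDr formZr form0r.
  rewrite [form _ Z' (shape _ _ _ _ _ _ _)](_ : _ = ip nu (normal_hessian g F u X' Z') (beta u *m v)).
    by rewrite [form _ Z' X']form_sym ?gS// => e; apply/eqP; rewrite -subr_eq0 -e; apply/eqP; ring.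
  rewrite (@form_adj _ _ _ eta _ (DJ_ X' u) Z' (beta u *m v)); last first.
    apply: (shapeE oA sF gE gU Fct) => //; first by rewrite mulmxA beta_tangent// mul0mx.
    by rewrite ip_sym beta_position.
  rewrite /normal_hessian /ip formDl formNl.
  have -> : form eta (J u *m christoffel g u X' Z') (beta u *m v) = 0.
    by rewrite -(@form_adj _ _ _ eta 1%:M (J u) _ _ 0) ?form0r// mulmx0 mulmxA beta_tangent// mul0mx.
  by rewrite subr0.
have n3 X1 Z1 X2 Z2 : ip nu (beta u *m b X1 Z1) (beta u *m b X2 Z2) =
    form (g u) Z1 (Phi_mx u X1 *m (L *m b X2 Z2)) +
    form (g u) Z2 (Phi_mx u X2 *m (L *m b X1 Z1)) +
    (c - ct) * dot (phi u) (b X1 Z1) * dot (phi u) (b X2 Z2).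
  rewrite /ip -form_mul.
  exact: (L_quadratic_identity (gS Au) L2 (ObE X1 Z1) (ObE X2 Z2)).
have n4 X' Z' : ct * ip nu (normal_hessian g F u X' Z') (F u) = - (ct * form (g u) X' Z').
  rewrite /normal_hessian /ip formDl formNl mulrDr mulrN.
  have := ip_position_tangent oA sF Fct (christoffel g u X' Z') Au; rewrite /ip => ->.
  by have := ip_hessian_position oA sF gE Fct X' Z' Au; rewrite /ip => ->; rewrite oppr0 addr0.
have n5 : ct * (ct * ip nu (F u) (F u)) = ct.
  have [->|ct0] := eqVneq ct 0; first by rewrite mul0r.
  by rewrite (Fct Au ct0) divff// mulr1.
have n6 v := beta_position v Au.
rewrite !pre_second_formE.
have expand (x1 y1 x2 y2 f : 'cV[R]_N) (k1 k2 : R) :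
    ip nu (x1 + y1 + (ct * k1) *: f) (x2 + y2 + (ct * k2) *: f) =
    ip nu x1 x2 + ip nu x1 y2 + ip nu x2 y1 + ip nu y1 y2 +
    k2 * (ct * ip nu x1 f) + k2 * (ct * ip nu y1 f) +
    k1 * (ct * ip nu x2 f) + k1 * (ct * ip nu y2 f) +
    k1 * k2 * (ct * (ct * ip nu f f)).
  rewrite (ip_sym _ x2 y1) (ip_sym _ x2 f) (ip_sym _ y2 f).
  by rewrite /ip !(formDl, formDr, formZl, formZr); ring.
rewrite expand.
have collect (i0 i1 i2 i3 BF1 bF1 BF2 bF2 FF d1 d2 q1 q2 D1 D2 p1 p2 : R) :
    ct * bF1 = 0 -> ct * bF2 = 0 -> ct * BF1 = - (ct * q1) -> ct * BF2 = - (ct * q2) ->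
    ct * (ct * FF) = ct -> d1 = q1 - D1 -> d2 = q2 - D2 ->
    i1 = - p1 - (c - ct) * d2 * q1 -> i2 = - p2 - (c - ct) * d1 * q2 ->
    i3 = p1 + p2 + (c - ct) * d1 * d2 ->
    i0 + i1 + i2 + i3 + d2 * (ct * BF1) + d2 * (ct * bF1) + d1 * (ct * BF2)
      + d1 * (ct * bF2) + d1 * d2 * (ct * (ct * FF)) = i0 + c * (D1 * D2 - q1 * q2).
  by move=> -> -> -> -> -> -> -> -> -> ->; ring.
exact: (collect _ _ _ _ _ _ _ _ _ _ _ _ _ _ _ _ _ (n6 (b X Z)) (n6 (b Y V))
  (n4 X Z) (n4 Y V) n5 (n1 X Z) (n1 Y V) (n2 X Z (b Y V)) (n2 Y V (b X Z))
  (n3 X Z Y V)).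
Qed.

End LTransform.
End Ribaucour.

(** * From sectional curvature to the curvature tensor *)

(** Polarizing S x x y y = S x y x y in x and in y gives
    2 S x y z w = S x z y w + S x w y z; permuting the variables, S is symmetric in
    all of them. Applied to S = <B, B> - c <,> <,>, this recovers a curvature tensor
    from its sectional curvatures. *)
Lemma polarization (R : realType) (V : zmodType) (S : V -> V -> V -> V -> R) :
  (forall x x' y z w, S (x + x') y z w = S x y z w + S x' y z w) ->
  (forall x y z w, S x y z w = S y x z w) ->
  (forall x y z w, S x y z w = S z w x y) ->
  (forall x y, S x x y y = S x y x y) ->
  forall x y z w, S x y z w = S x z y w.
Proof.
move=> S1 sym pair h.
have S2 x y y' z w : S x (y + y') z w = S x y z w + S x y' z w.
  by rewrite sym S1 !(sym x).
have S3 x y z z' w : S x y (z + z') w = S x y z w + S x y z' w.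
  by rewrite pair S1 !(pair x).
have S4 x y z w w' : S x y z (w + w') = S x y z w + S x y z w'.
  by rewrite pair S2 !(pair x).
have h1 x x' y : S x x' y y = S x y x' y.
  have := h (x + x') y; rewrite !(S1, S2, S3, S4) (h x) (h x') (sym x' x).
  rewrite (pair x' y x y); lra.
have h2 x x' y y' : S x x' y y' + S x x' y y' = S x y x' y' + S x y' x' y.
  have := h1 x x' (y + y'); rewrite !(S1, S2, S3, S4) !h1.
  rewrite (pair x x' y' y) (sym y' y) -(pair x x' y y').
  lra.
move=> x y z w; have e1 := h2 x y z w; have e2 := h2 x z y w.
have e3 : S x w z y = S x w y z by rewrite pair sym -pair.
lra.
Qed.

Section Rank2.
Variables (R : realType) (n : nat).
Implicit Types X Y : 'cV[R]_n.

Lemma rank_row_mx_scale X (k l : R) : (\rank (row_mx (k *: X) (l *: X)) <= 1)%N.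
Proof.
have -> : row_mx (k *: X) (l *: X) = X *m row_mx k%:M l%:M.
  by rewrite mul_mx_row !mul_mx_scalar.
exact: leq_trans (mxrankM_maxl _ _) (rank_leq_col _).
Qed.

Lemma rank2_independent X Y : \rank (row_mx X Y) = 2%N ->
  X != 0 /\ forall k, Y != k *: X.
Proof.
move=> r; split=> [|k]; apply/eqP => e; move: r; rewrite e.
  have := rank_row_mx_scale Y 0 1; rewrite scale0r scale1r.
  by move=> + e'; rewrite e'.
have := rank_row_mx_scale X 1 k; rewrite scale1r.
by move=> + e'; rewrite e'.
Qed.

(** A nonzero vector in the kernel gives the linear relation. *)
Lemma rank_neq2_dependent X Y : \rank (row_mx X Y) != 2%N ->
  X = 0 \/ exists k, Y = k *: X.
Proof.
rewrite -mxrank_tr => r.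
have : kermx (row_mx X Y)^T != 0.
  by rewrite kermx_eq0 /row_free.
move/rowV0Pn => [v /sub_kermxP vk v0].
move: vk; rewrite tr_row_mx -[v]hsubmxK mul_row_col.
rewrite [lsubmx v]mx11_scalar [rsubmx v]mx11_scalar !mul_scalar_mx.
set a := lsubmx v 0 0; set b := rsubmx v 0 0 => e.
have {e} e : a *: X + b *: Y = 0.
  by apply: trmx_inj; rewrite linearD !linearZ/= trmx0.
have [b0|b0] := eqVneq b 0.
  left; move: e; rewrite b0 scale0r addr0 => /eqP; rewrite scaler_eq0 => /orP[|/eqP//].
  move/eqP => a0; case/negP: v0; rewrite -[v]hsubmxK.
  by rewrite [lsubmx v]mx11_scalar [rsubmx v]mx11_scalar -/a -/b a0 b0 raddf0 row_mx0.
right; exists (- (b^-1 * a)); apply: (scalerI b0); rewrite scalerA mulrN mulrA divff// mul1r scaleNr.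
by apply/eqP; rewrite -addr_eq0 addrC e.
Qed.

End Rank2.

Section SectionalCurvature.
Variables (R : realType) (n : nat) (A : 'M[R]_n).
Hypothesis sA : A^T = A.
Hypothesis pA : forall X : 'cV[R]_n, X != 0 -> 0 < form A X X.
Implicit Types X Y : 'cV[R]_n.

Lemma posdef_unit : A \in unitmx.
Proof.
rewrite -row_free_unit -kermx_eq0; apply: contraT => /rowV0Pn[v /sub_kermxP vk v0].
have vt0 : v^T != 0 by apply: contraNneq v0 => /(congr1 trmx); rewrite trmxK trmx0 => ->.
by have := pA vt0; rewrite /form trmxK vk mul0mx mxE ltxx.
Qed.

(** Strict Cauchy-Schwarz inequality: the area is, up to the factor <X, X>, the
    square norm of the nonzero vector <X, X> Y - <X, Y> X. *)
Lemma area_neq0 X Y : \rank (row_mx X Y) = 2%N ->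
  form A X X * form A Y Y - form A X Y ^+ 2 != 0.
Proof.
move=> /rank2_independent[X0 XY].
have pX := pA X0.
have Z0 : form A X X *: Y - form A X Y *: X != 0.
  apply/eqP => e; have /eqP[] := XY (form A X Y / form A X X).
  apply: (@scalerI _ _ (form A X X)); first by rewrite gt_eqF.
  rewrite scalerA mulrCA divff ?gt_eqF// mulr1.
  by apply/eqP; rewrite -subr_eq0 e.
have := pA Z0; rewrite !(formDl, formDr, formZl, formZr, formNl, formNr).
rewrite (form_sym Y X sA) => H; apply/eqP => e.
have : form A X X * (form A X X * form A Y Y - form A X Y ^+ 2) = 0.
  by rewrite e mulr0.
lra.
Qed.

End SectionalCurvature.

(** Dependent X and Y satisfy the identity trivially, so that the hypothesis on
    planes is enough for polarization. *)
Lemma gauss_polarization (R : realType) (N nu n : nat) (c : R)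
    (B : 'cV[R]_n -> 'cV[R]_n -> 'cV[R]_N) (q : 'cV[R]_n -> 'cV[R]_n -> R) :
  (forall X X' Y, B (X + X') Y = B X Y + B X' Y) ->
  (forall k X Y, B (k *: X) Y = k *: B X Y) ->
  (forall X Y, B X Y = B Y X) ->
  (forall X X' Y, q (X + X') Y = q X Y + q X' Y) ->
  (forall k X Y, q (k *: X) Y = k * q X Y) ->
  (forall X Y, q X Y = q Y X) ->
  (forall X Y, \rank (row_mx X Y) = 2%N ->
    ip nu (B X X) (B Y Y) - ip nu (B X Y) (B X Y) =
    c * (q X X * q Y Y - q X Y ^+ 2)) ->
  forall X Y Z V, ip nu (B X Z) (B Y V) - ip nu (B Y Z) (B X V) =
    c * (q X Z * q Y V - q Y Z * q X V).
Proof.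
move=> BD BZ BS qD qZ qS h.
pose S X Z Y V := ip nu (B X Z) (B Y V) - c * (q X Z * q Y V).
suff TS X Z Y V : S X Z Y V = S X Y Z V.
  move=> X Y Z V; have e : S X Y Z V = S Y X Z V by rewrite /S BS qS.
  have := etrans (TS X Z Y V) (etrans e (TS Y X Z V)).
  rewrite /S; lra.
move: X Z Y V; apply: polarization => [X X' Z Y V|X Z Y V|X Z Y V|X Y].
- by rewrite /S BD qD /ip formDl; ring.
- by rewrite /S BS qS.
- by rewrite /S ip_sym (mulrC (q X Z)).
- have [r|/rank_neq2_dependent] := eqVneq (\rank (row_mx X Y)) 2%N.
    by have := h X Y r; rewrite /S; lra.
  have B0 Z : B 0 Z = 0 by rewrite -(scale0r 0) BZ scale0r.
  have q0 Z : q 0 Z = 0 by rewrite -(scale0r 0) qZ mul0r.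
  case=> [->|[k ->]]; first by rewrite /S !B0 !q0 /ip !form0l !mul0r.
  rewrite /S (BS X (k *: X)) (qS X (k *: X)) !BZ !qZ (BS X (k *: X)) (qS X (k *: X)) BZ qZ.
  by rewrite /ip !(formZl, formZr); ring.
Qed.

(** * Curvature of an L-transform in coordinates *)

Section LTransformCurvature.
Variables (R : realType) (N nu n m : nat) (c ct : R) (A : set 'cV[R]_n).
Variables (g : 'cV[R]_n -> 'M[R]_n) (F : 'cV[R]_n -> 'cV[R]_N).
Variables (phi : 'cV[R]_n -> 'cV[R]_m) (beta : 'cV[R]_n -> 'M[R]_(N, m)).
Variables (Omega : 'cV[R]_n -> 'M[R]_m) (L : 'M[R]_m) (Ft : 'cV[R]_n -> 'cV[R]_N).
Hypothesis oA : open A.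
Hypothesis sF : smooth_on A F.
Hypothesis gE : forall u, A u -> g u = gram nu F u.
Hypothesis gpos : forall u, A u -> forall X : 'cV[R]_n, X != 0 -> 0 < form (g u) X X.

Let gS u : A u -> (g u)^T = g u. Proof. by move=> Au; rewrite gE// gram_sym. Qed.
Let gU u : A u -> g u \in unitmx. Proof. by move=> Au; apply: posdef_unit; exact: gpos. Qed.

Lemma normal_hessianDl u X X' Y : A u -> normal_hessian g F u (X + X') Y =
  normal_hessian g F u X Y + normal_hessian g F u X' Y.
Proof.
move=> Au.
have sJ : smooth_on A (jac F) by exact: smooth_jac.
have dJ : 'D_(X + X') (jac F) u = 'D_X (jac F) u + 'D_X' (jac F) u.
  by rewrite !deriveE ?linearD//; exact: smooth_diff sJ Au.
have tc := tangent_christoffel oA sF gE gU.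
rewrite /normal_hessian !tc// dJ mulmxDl /tangent_part !mulmxDr.
by rewrite opprD addrACA.
Qed.

Lemma normal_hessianZl u k X Y : A u -> normal_hessian g F u (k *: X) Y =
  k *: normal_hessian g F u X Y.
Proof.
move=> Au.
have sJ : smooth_on A (jac F) by exact: smooth_jac.
have dJ : 'D_(k *: X) (jac F) u = k *: 'D_X (jac F) u.
  by rewrite !deriveE ?linearZ//; exact: smooth_diff sJ Au.
have tc := tangent_christoffel oA sF gE gU.
rewrite /normal_hessian !tc// dJ -scalemxAl /tangent_part -!scalemxAr.
by rewrite scalerBr.
Qed.

Lemma normal_hessian_sym u X Y : A u ->
  normal_hessian g F u X Y = normal_hessian g F u Y X.
Proof.
move=> Au; have tc := tangent_christoffel oA sF gE gU.
have e := hessian_sym oA sF X Y Au.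
rewrite /normal_hessian (tc u X Y Au) (tc u Y X Au).
exact: (congr1 (fun w => w - jac F u *m tangent_part nu g F u w) e).
Qed.

(** The Gauss equation of F, combined with the value of its curvature. *)
Lemma constant_curvature_gauss u : A u ->
  (forall X Y, \rank (row_mx X Y) = 2%N -> sectional_curvature g u X Y = c) ->
  forall X Y Z V,
  ip nu (normal_hessian g F u X Z) (normal_hessian g F u Y V) -
  ip nu (normal_hessian g F u Y Z) (normal_hessian g F u X V) =
  c * (form (g u) X Z * form (g u) Y V - form (g u) Y Z * form (g u) X V).
Proof.
move=> Au sec.
have qS X Y : form (g u) X Y = form (g u) Y X by apply: form_sym; exact: gS.
apply: (@gauss_polarization _ _ nu _ c (normal_hessian g F u) (form (g u))).
- by move=> X X' Y; exact: normal_hessianDl.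
- by move=> k X Y; exact: normal_hessianZl.
- by move=> X Y; exact: normal_hessian_sym.
- by move=> X X' Y; exact: formDl.
- by move=> k X Y; exact: formZl.
- exact: qS.
move=> X Y r; have := sec X Y r; rewrite /sectional_curvature.
have a0 := area_neq0 (gS Au) (gpos Au) r.
move/(canRL (divfK a0)) => <-.
rewrite (gauss_equation oA sF gE gU X Y Y X Au).
by rewrite (normal_hessian_sym Y X Au).
Qed.

Hypothesis Fct : forall u, A u -> space_form nu ct (F u).
Hypothesis sphi : smooth_on A phi.
Hypothesis sbeta : smooth_on A beta.
Hypothesis sOmega : smooth_on A Omega.
Hypothesis rib : forall u, A u -> ribaucour_at nu ct g F phi beta Omega u.
Hypothesis FtE : forall u, A u -> Ft u = ribaucour_transform ct g F phi beta Omega u.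
Hypothesis Lc : forall u, A u -> L_condition_at nu ct g F phi beta Omega c L u.

(** At a regular point D is injective, and the new metric is the old one composed
    with D. *)
Lemma gram_transform_posdef u : A u -> \rank (jac Ft u) = n ->
  forall X : 'cV[R]_n, X != 0 -> 0 < form (gram nu Ft u) X X.
Proof.
move=> Au rk X X0.
rewrite (gram_transform oA sF gE gU Fct sphi sbeta sOmega rib FtE Au) form_mul.
apply: gpos => //; apply: contraNneq X0 => DX.
have : jac Ft u *m X = 0.
  by rewrite (jac_transform oA sF gE gU Fct sphi sbeta sOmega rib FtE Au) -mulmxA DX mulmx0.
move/(congr1 trmx); rewrite trmx_mul trmx0 => /eqP.
have fr : row_free (jac Ft u)^T by rewrite /row_free mxrank_tr rk.
by rewrite mulmx_free_eq0// => /eqP /(congr1 trmx); rewrite trmxK trmx0 => ->.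
Qed.

(** In the Gauss equation of the transform, ip_pre_second_form replaces the second
    fundamental form by that of F at the cost of metric terms, and the Gauss
    equation of F turns the rest into metric terms as well. Only
    c (<DX, DX> <DY, DY> - <DX, DY> ^ 2) survives. *)
Lemma L_transform_sectional u X Y : A u ->
  (forall X Y, \rank (row_mx X Y) = 2%N -> sectional_curvature g u X Y = c) ->
  \rank (jac Ft u) = n -> \rank (row_mx X Y) = 2%N ->
  sectional_curvature (gram nu Ft) u X Y = c.
Proof.
move=> Au sec rk r.
have pt := gram_transform_posdef Au rk.
have a0 := area_neq0 (gram_sym _ _ _) pt r.
have gt1 := gram_transform oA sF gE gU Fct sphi sbeta sOmega rib FtE Au.
have ru : transform_regular nu A Ft u by split=> //; apply: posdef_unit.
apply: (mulIf a0); rewrite /sectional_curvature divfK//.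
have gtE V W : form (gram nu Ft u) V W =
    form (g u) (ribD nu ct g F phi beta Omega Ft u *m V) (ribD nu ct g F phi beta Omega Ft u *m W).
  by rewrite gt1 form_mul.
rewrite (gtE X X) (gtE Y Y) (gtE X Y).
apply: etrans (gauss_transform oA sF gE gU Fct sphi sbeta sOmega rib FtE X Y Y X ru) _.
set D := ribD _ _ _ _ _ _ _ _ _.
have gDS : form (g u) (D *m Y) (D *m X) = form (g u) (D *m X) (D *m Y).
  by apply: form_sym; exact: gS.
have e1 := ip_pre_second_form oA sF gE gU Fct sphi sbeta sOmega rib FtE Lc X Y (D *m X) (D *m Y) Au.
have e2 := ip_pre_second_form oA sF gE gU Fct sphi sbeta sOmega rib FtE Lc Y X (D *m X) (D *m Y) Au.
have e3 := constant_curvature_gauss Au sec X Y (D *m X) (D *m Y).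
have collect (i1 i2 b1 b2 xx yy xy yx dXX dYY dXY dYX : R) :
    dYX = dXY -> i1 = b1 + c * (dXX * dYY - xx * yy) ->
    i2 = b2 + c * (dYX * dXY - yx * xy) -> b1 - b2 = c * (xx * yy - yx * xy) ->
    i1 - i2 = c * (dXX * dYY - dXY ^+ 2).
  by move=> -> -> -> e; rewrite -[b1](subrK b2) e; ring.
exact: (collect _ _ _ _ _ _ _ _ _ _ _ _ gDS e1 e2 e3).
Qed.

End LTransformCurvature.

(** * From charts to the manifold *)

Lemma jac_comp (R : realType) (n n' m : nat) (h : 'cV[R]_n' -> 'cV[R]_m)
    (t : 'cV[R]_n -> 'cV[R]_n') u :
  differentiable t u -> differentiable h (t u) ->
  jac (h \o t) u = jac h (t u) *m jac t u.
Proof.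
move=> dt dh; apply: mx_eq_mul => X.
have dht : differentiable (h \o t) u by exact: differentiable_comp.
rewrite (jac_mulE X dht) -mulmxA (jac_mulE X dt) (jac_mulE _ dh).
rewrite (@deriveE _ _ _ _ _ _ dht) (@deriveE _ _ _ _ _ _ dt) (@deriveE _ _ _ _ _ _ dh).
by rewrite diff_comp.
Qed.

Section Atlas.
Variables (R : realType) (n : nat) (M : smooth_manifold R n).
Implicit Types k : chart R n M.

Lemma coord_param k u : atlas k -> chart_codom k u ->
  dom k (param k u) /\ coord k (param k u) = u.
Proof.
by move=> ak [x kx <-]; have [_ _ pc _ _] := atlas_chart ak; rewrite pc.
Qed.

Lemma open_overlap k k' : atlas k -> atlas k' -> open (overlap k k').
Proof.
move=> ak ak'; rewrite openE => u [ku k'u].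
have [_ oc _ _ cp] := atlas_chart ak; have [od' _ _ _ _] := atlas_chart ak'.
apply: filterI; first exact: near_open.
by apply: cp => //; apply: open_nbhs_nbhs.
Qed.

Variables (N : nat) (h : M -> 'cV[R]_N).
Hypothesis sh : smooth_map h.

Lemma jac_transition k k' u : atlas k -> atlas k' -> overlap k k' u ->
  jac (h \o param k) u =
  jac (h \o param k') (transition k k' u) *m jac (transition k k') u.
Proof.
move=> ak ak' ou.
have [_ _ pc' _ _] := atlas_chart ak'.
have tk' : chart_codom k' (transition k k' u) by exists (param k u) => //; case: ou.
rewrite -jac_comp.
- apply/matrixP => a i; rewrite !mxE.
  congr (fun_of_matrix _ a 0).
  apply: (derive_eq_on (open_overlap ak ak')) ou.
  by move=> w [kw k'w]; rewrite /transition /= pc'.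
- exact: smooth_diff (atlas_smooth ak ak') ou.
- exact: smooth_diff (sh ak') tk'.
Qed.

(** By the chain rule; with the two charts exchanged, the ranks are equal. *)
Lemma rank_jac_le k k' x : atlas k -> atlas k' -> dom k x -> dom k' x ->
  (\rank (jac (h \o param k) (coord k x)) <= \rank (jac (h \o param k') (coord k' x)))%N.
Proof.
move=> ak ak' kx k'x; have [_ _ pc _ _] := atlas_chart ak.
have ou : overlap k k' (coord k x) by split; [exists x|rewrite /= pc].
rewrite (jac_transition ak ak' ou) /transition /= pc//.
exact: mxrankM_maxl.
Qed.

End Atlas.

Lemma rank_jac_gram_unit (R : realType) (N nu n : nat) (h : 'cV[R]_n -> 'cV[R]_N) u :
  gram nu h u \in unitmx -> \rank (jac h u) = n.
Proof.
move=> /mxrank_unit gu; apply/eqP; rewrite eqn_leq rank_leq_col -[X in (X <= _)%N]gu.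
exact: mxrankM_maxr.
Qed.

Section InducedMetric.
Variables (R : realType) (N nu n : nat) (M : smooth_manifold R n).
Variable h : M -> 'cV[R]_N.
Hypothesis sh : smooth_map h.

Lemma regular_pointsP k u : atlas k -> chart_codom k u ->
  regular_points h (param k u) -> \rank (jac (h \o param k) u) = n.
Proof.
move=> ak ku /(_ k ak); have [kp cp] := coord_param ak ku.
by rewrite cp; apply.
Qed.

Lemma gram_smooth_chart k : atlas k -> smooth_on (chart_codom k) (gram nu (h \o param k)).
Proof.
by move=> ak; have [_ oc _ _ _] := atlas_chart ak; apply: gram_smooth oc (sh ak) _.
Qed.

Hypothesis hpos : forall k u, atlas k -> chart_codom k u ->
  \rank (jac (h \o param k) u) = n ->
  forall X : 'cV[R]_n, X != 0 -> 0 < form (gram nu (h \o param k) u) X X.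

(** Regularity at one chart is the invertibility of a Gram matrix, an open
    condition, and it does not depend on the chart. *)
Lemma open_regular_points : open (regular_points h).
Proof.
rewrite openE => x Sx; have [k ak kx] := atlas_cover x.
have [od oc pc cc cp] := atlas_chart ak.
have kc : chart_codom k (coord k x) by exists x.
have gu : gram nu (h \o param k) (coord k x) \in unitmx.
  by apply: posdef_unit; apply: hpos => //; exact: Sx.
have ng := near_unitmx (smooth_diff (gram_smooth_chart ak) kc) gu.
have nx : \forall y \near x, dom k y /\ gram nu (h \o param k) (coord k y) \in unitmx.
  by apply: filterI; [apply: open_nbhs_nbhs|exact: cc ng].
apply: filterS nx => y [ky gy] k' ak' k'y.
apply/eqP; rewrite eqn_leq rank_leq_col /=.
apply: leq_trans (rank_jac_le sh ak ak' ky k'y).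
by rewrite (rank_jac_gram_unit gy).
Qed.

Lemma riemannian_induced : riemannian_on (regular_points h) (induced_metric nu h).
Proof.
split=> [|k ak|k u ak ku Su|k u ak ku Su|k k' u ak ak' ou Su].
- exact: open_regular_points.
- by apply: smooth_subset (gram_smooth_chart ak) => u [].
- exact: gram_sym.
- by apply: hpos => //; exact: regular_pointsP.
- rewrite /induced_metric /gram (jac_transition sh ak ak' ou) trmx_mul.
  by rewrite !mulmxA.
Qed.

End InducedMetric.

Lemma L_transform_constant_curvature (R : realType) (N nu n : nat) (c ct : R)
    (M : smooth_manifold R n) (g : tensor2 M) (f ft : M -> 'cV[R]_N) :
  constant_curvature_on [set: M] g c -> isometric_immersion nu ct g f ->
  is_L_transform nu ct g c f ft ->
  constant_curvature_on (regular_points ft) (induced_metric nu ft) c.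
Proof.
move=> [[_ _ _ gpos _] gsec] [sf fct gE].
move=> [m [phi [beta [ Omega [L [[sphi sbeta sOmega rib] Lc]]]]]].
have oA (k : chart R n M) : atlas k -> open (chart_codom k) by move=> ak; have [] := atlas_chart ak.
have gE' k (ak : atlas k) u : chart_codom k u -> g k u = gram nu (f \o param k) u.
  by move=> ku; rewrite -gE.
have gp k (ak : atlas k) u : chart_codom k u -> forall X, X != 0 -> 0 < form (g k u) X X.
  by move=> ku; apply: gpos.
have gU k (ak : atlas k) u : chart_codom k u -> g k u \in unitmx.
  by move=> ku; apply: posdef_unit; exact: gp.
have fct' k (ak : atlas k) u : chart_codom k u -> space_form nu ct ((f \o param k) u).
  by move=> _; exact: fct.
have rib1 k (ak : atlas k) u : chart_codom k u -> ribaucour_at nu ct (g k) (f \o param k)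
    (phi \o param k) (beta \o param k) (Omega \o param k) u.
  by move=> ku; have [] := rib k u ak ku.
have rib2 k (ak : atlas k) u : chart_codom k u -> (ft \o param k) u =
    ribaucour_transform ct (g k) (f \o param k)
    (phi \o param k) (beta \o param k) (Omega \o param k) u.
  by move=> ku; have [] := rib k u ak ku.
have Lc' k (ak : atlas k) u := Lc k u ak.
have sft : smooth_map ft.
  move=> k ak. exact: (transform_smooth (oA k ak) (sf k ak) (gE' k ak) (gU k ak)
    (sphi k ak) (sbeta k ak) (sOmega k ak) (rib1 k ak) (rib2 k ak)).
split=> [|k u ak ku Su X Y r].
  apply: riemannian_induced => // k u ak ku rk.
  exact: (gram_transform_posdef (oA k ak) (sf k ak) (gE' k ak) (gp k ak) (fct' k ak)
    (sphi k ak) (sbeta k ak) (sOmega k ak) (rib1 k ak) (rib2 k ak)).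
apply: (L_transform_sectional (oA k ak) (sf k ak) (gE' k ak) (gp k ak) (fct' k ak)
    (sphi k ak) (sbeta k ak) (sOmega k ak) (rib1 k ak) (rib2 k ak)
    (Lc' k ak)) => //.
  by move=> X' Y' r'; apply: gsec.
exact: regular_pointsP.
Qed.

Theorem theorem13 (R : realType) (n p s : nat) (c ct : R)
    (M : smooth_manifold R n) (g : tensor2 M)
    (f ft : M -> 'cV[R]_(ambient_dim (n + p) ct)) :
  (s <= n + p)%N ->
  constant_curvature_on [set: M] g c ->
  isometric_immersion (ambient_index s ct) ct g f ->
  is_L_transform (ambient_index s ct) ct g c f ft ->
  constant_curvature_on (regular_points ft)
    (induced_metric (ambient_index s ct) ft) c.
Proof. move=> _; exact: L_transform_constant_curvature. Qed.
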